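(* Let $r\ge 2$, let $f\in P=\mathbb{C}[X_0,\dots,X_r]$ be a reduced homogeneous polynomial of degree $d$, and let $X=V(f)\subset\mathbb{P}^r$. The vector space $H^0_{\mathbf{m}}(R(f))_d$ is naturally identified with the space of first order locally trivial deformations of $X$ in $\mathbb{P}^r$ modulo the action of $\mathrm{PGL}(r+1)$.
   Context: $R(f)=P/J(f)$ is the jacobian ring of $f$, where $J(f)=\left(\frac{\partial f}{\partial X_0},\dots,\frac{\partial f}{\partial X_r}\right)$. $\mathbf{m}=(X_0,\dots,X_r)$, and $H^0_{\mathbf{m}}(R(f))=J(f)^{sat}/J(f)$ is the $0$-th local cohomology module of $R(f)$ with respect to $\mathbf{m}$ ($J(f)^{sat}$ is the saturation); the subscript $d$ denotes its degree $d$ part. A first order locally trivial deformation of $X$ in $\mathbb{P}^r$ is a closed subscheme $\mathcal{X}\subset\mathbb{P}^r\times\mathrm{Spec}(\mathbb{C}[\epsilon]/(\epsilon^2))$, flat over $\mathrm{Spec}(\mathbb{C}[\epsilon]/(\epsilon^2))$, restricting to $X$ over the closed point, which is locally on $X$ isomorphic to the trivial deformation. These form the vector space $H^0(X,N'_X)$, where $N'_X$ is the image of the natural map $T_{\mathbb{P}^r}\to N_{X/\mathbb{P}^r}=\mathcal{O}_X(d)$. Taking it modulo the action of $\mathrm{PGL}(r+1)$ means taking the quotient by the image of $H^0(\mathbb{P}^r,T_{\mathbb{P}^r})$, the Lie algebra of $\mathrm{PGL}(r+1)$. *)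

(* Defs.v *)
From HB Require Import structures.
From mathcomp Require Import all_boot all_order all_algebra.
From mathcomp Require Import functions mpoly.

Set Implicit Arguments.
Unset Strict Implicit.
Unset Printing Implicit Defensive.

Import GRing.Theory.
Local Open Scope ring_scope.

(* The ring F[eps]/(eps^2); the pair (a, b) stands for a + b * eps. *)
Definition dual (F : comNzRingType) : Type := (F * F)%type.

Section DualNumbers.
Variable F : comNzRingType.
Implicit Types x y z : dual F.

HB.instance Definition _ := GRing.Zmodule.copy (dual F) (F * F)%type.

Definition dual_one : dual F := (1, 0).
Definition dual_mul x y : dual F := (x.1 * y.1, x.1 * y.2 + x.2 * y.1).

Fact dual_mulA : associative dual_mul.
Proof.
move=> [a a'] [b b'] [c c']; congr pair => /=; first by rewrite mulrA.
by rewrite mulrDr mulrDl !mulrA addrA.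
Qed.

Fact dual_mulC : commutative dual_mul.
Proof.
move=> [a a'] [b b']; congr pair => /=; first by rewrite mulrC.
by rewrite addrC mulrC (mulrC a).
Qed.

Fact dual_mul1 : left_id dual_one dual_mul.
Proof. by move=> [a a']; congr pair => /=; rewrite !mul1r // mul0r addr0. Qed.

Fact dual_mulD : left_distributive dual_mul +%R.
Proof.
move=> [a a'] [b b'] [c c']; congr pair => /=; first by rewrite mulrDl.
by rewrite !mulrDl addrACA.
Qed.

Fact dual_one_neq0 : dual_one != 0.
Proof. by apply/eqP => -[/eqP]; rewrite (negPf (oner_neq0 _)). Qed.

HB.instance Definition _ := GRing.Zmodule_isComNzRing.Build (dual F)
  dual_mulA dual_mulC dual_mul1 dual_mulD dual_one_neq0.

End DualNumbers.

Section Subquotients.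
Variables (F : nzRingType) (V W : lmodType F).

Definition subspace (M : lmodType F) (U : M -> Prop) : Prop :=
  U 0 /\ forall (a : F) u v, U u -> U v -> U (a *: u + v).

(* phi induces an isomorphism of vector spaces V1 / V0 -> W1 / W0. *)
Definition induces_iso (V1 V0 : V -> Prop) (W1 W0 : W -> Prop)
    (phi : V -> W) : Prop :=
  [/\ [/\ subspace V1, subspace V0 & forall v, V0 v -> V1 v],
      [/\ subspace W1, subspace W0 & forall w, W0 w -> W1 w],
      [/\ linear phi, forall v, V1 v -> W1 (phi v)
        & forall v, V0 v -> W0 (phi v)],
      forall v, V1 v -> W0 (phi v) -> V0 v
    & forall w, W1 w -> exists2 v, V1 v & W0 (w - phi v)].

End Subquotients.

(* The function field of affine space, as a vector space over the constants.  *)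
(* All sections of sheaves on open subsets of P^r used below are elements of  *)
(* this field; those over C[eps] are elements of [dual (ratfun C n)].         *)
Definition ratfun (F : fieldType) (n : nat) : Type := {fraction {mpoly F[n]}}.

Section RationalFunctions.
Variables (F : fieldType) (n : nat).

HB.instance Definition _ := GRing.Field.copy (ratfun F n) {fraction {mpoly F[n]}}.

Definition ofpoly (p : {mpoly F[n]}) : ratfun F n := tofrac p.

Definition ratfun_scale (c : F) (x : ratfun F n) : ratfun F n :=
  ofpoly c%:MP * x.

Fact ratfun_scaleA a b x :
  ratfun_scale a (ratfun_scale b x) = ratfun_scale (a * b) x.
Proof. by rewrite /ratfun_scale /ofpoly mulrA mpolyCM tofracM. Qed.

Fact ratfun_scale1 : left_id 1 ratfun_scale.
Proof. by move=> x; rewrite /ratfun_scale /ofpoly mpolyC1 tofrac1 mul1r. Qed.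

Fact ratfun_scaleDr : right_distributive ratfun_scale +%R.
Proof. by move=> a x y; rewrite /ratfun_scale mulrDr. Qed.

Fact ratfun_scaleDl x : {morph ratfun_scale^~ x : a b / a + b}.
Proof.
by move=> a b; rewrite /ratfun_scale /ofpoly mpolyCD tofracD mulrDl.
Qed.

HB.instance Definition _ := GRing.Zmodule_isLmodule.Build F (ratfun F n)
  ratfun_scaleA ratfun_scale1 ratfun_scaleDr ratfun_scaleDl.

End RationalFunctions.

Section Geometry.
Variables (C : fieldType) (n : nat).
Local Notation P := {mpoly C[n]}.
Local Notation K := (ratfun C n).
Local Notation A := (dual C).
Local Notation KE := (dual K).

(* No multiple factors; this forces f != 0. *)
Definition reduced_poly (f : P) : Prop :=
  forall p q : P, f = p ^+ 2 * q -> p \is a GRing.unit.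

(** ** The jacobian ideal and its saturation *)

Definition jacobian_ideal (f g : P) : Prop :=
  exists a : 'I_n -> P, g = \sum_(i < n) a i * f^`M(i).

(* g * m^k is contained in J(f) for some k; m^k is generated by the monomials *)
(* of degree k.                                                               *)
Definition jacobian_sat (f g : P) : Prop :=
  exists k : nat, forall m : 'X_{1..n}, mdeg m = k ->
    jacobian_ideal f ('X_[m] * g).

(* H^0_m(R(f))_d is the quotient of [Jsat_deg f d] by [J_deg f d]. *)
Definition Jsat_deg (f : P) (d : nat) (g : P) : Prop :=
  g \is d.-homog /\ jacobian_sat f g.

Definition J_deg (f : P) (d : nat) (g : P) : Prop :=
  g \is d.-homog /\ jacobian_ideal f g.

(** ** Projective space: points and basic affine open subsets *)

(* The points of Proj C[X_0, ..., X_(n-1)]. *)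
Definition proj_point (p : P -> Prop) : Prop :=
  [/\ p 0 /\ (forall a b c, p a -> p b -> p (c * a + b)),
      ~ p 1 /\ (forall a b, p (a * b) -> p a \/ p b),
      forall a k, p a -> p (pihomog mdeg k a)
    & exists i : 'I_n, ~ p 'X_i].

(* The h for which D+(h) belongs to the base of affine open subsets of Proj;  *)
(* D+(h) and D+(g) meet in D+(h * g).                                         *)
Definition basic_open (h : P) : Prop :=
  h != 0 /\ exists2 e : nat, (0 < e)%N & h \is e.-homog.

(* Sections over D+(h) of O(k), the degree k part of P[1/h]. *)
Definition twist (h : P) (k : int) (x : K) : Prop :=
  exists (p : P) (e l j : nat),
    [/\ h \is e.-homog, p \is l.-homog, l%:Z = k + (j * e)%:Z
      & x = ofpoly p / ofpoly h ^+ j].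

Definition regular (h : P) (x : K) : Prop := twist h 0 x.

(* Functions on D+(h) x Spec C[eps]. *)
Definition regular_eps (h : P) (x : KE) : Prop := regular h x.1 /\ regular h x.2.

(* Sections over D+(h) of the tangent sheaf: C-derivations of the coordinate  *)
(* ring of D+(h).  Only the values of D on that ring matter.                  *)
Definition vector_field (h : P) (D : K -> K) : Prop :=
  [/\ forall x, regular h x -> regular h (D x),
      forall c x y, regular h x -> regular h y ->
        D (c *: x + y) = c *: D x + D y
    & forall x y, regular h x -> regular h y ->
        D (x * y) = x * D y + y * D x].

Definition global_vector_field (D : P -> K -> K) : Prop :=
  (forall h, basic_open h -> vector_field h (D h)) /\
  (forall h g x, basic_open h -> basic_open g -> regular h x ->
     D (h * g) x = D h x).

(** ** The hypersurface X = V(f), with f homogeneous of degree d *)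

Variables (f : P) (d : nat).

(* Kernel of O(k) -> O_X(k) over D+(h); for k = 0, the ideal of X. *)
Definition vanishing (h : P) (k : int) (x : K) : Prop :=
  exists2 u : K, twist h (k - d%:Z) u & x = u * ofpoly f.

(* A section over X of N_X = O_X(d), given by representatives s h in O(d)     *)
(* over each D+(h).                                                           *)
Definition normal_section (s : P -> K) : Prop :=
  (forall h, basic_open h -> twist h d%:Z (s h)) /\
  (forall h g, basic_open h -> basic_open g ->
     vanishing (h * g) d%:Z (s (h * g) - s h)).

Definition zero_section (s : P -> K) : Prop :=
  forall h, basic_open h -> vanishing h d%:Z (s h).

(* Over D+(h), the vector field D is sent to t by T_(P^r) -> N_X.  A section  *)
(* t of O_X(d) is viewed as the element u * f |-> u * t of Hom(I_X, O_X), and *)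
(* the image of D is the restriction of D to I_X, modulo I_X.                 *)
Definition normal_image (D : K -> K) (h : P) (t : K) : Prop :=
  forall u, twist h (- d%:Z) u ->
    vanishing h 0 (D (u * ofpoly f) - u * t).

(* H^0(X, N'_X): a section of the image sheaf is a section of N_X which is    *)
(* the image of a vector field in a neighbourhood of each point of X.         *)
Definition H0_N' (s : P -> K) : Prop :=
  normal_section s /\
  forall p, proj_point p -> p f ->
    exists h D, [/\ basic_open h, ~ p h, vector_field h D
                  & normal_image D h (s h)].

(* The image of H^0(P^r, T_(P^r)) in H^0(X, N'_X). *)
Definition image_H0_T (s : P -> K) : Prop :=
  normal_section s /\
  exists2 D, global_vector_field D
    & forall h, basic_open h -> normal_image (D h) h (s h).

(** ** First order deformations *)

Definition constant_eps (a : A) : KE :=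
  (ofpoly (a.1)%:MP, ofpoly (a.2)%:MP).

Definition is_ideal (S I : KE -> Prop) : Prop :=
  [/\ I 0, forall x, I x -> S x
    & forall a x y, S a -> I x -> I y -> I (a * x + y)].

Definition ideal_span (S G : KE -> Prop) (x : KE) : Prop :=
  exists2 t : seq (KE * KE), (forall z, z \in t -> S z.1 /\ G z.2)
    & x = \sum_(z <- t) z.1 * z.2.

(* A closed subscheme of P^r x Spec C[eps]: a quasi-coherent sheaf of ideals, *)
(* given on the base of the D+(h) x Spec C[eps].                              *)
Definition closed_subscheme (I : P -> KE -> Prop) : Prop :=
  (forall h, basic_open h -> is_ideal (regular_eps h) (I h)) /\
  (forall h g x, basic_open h -> basic_open g ->
     I (h * g) x <-> ideal_span (regular_eps (h * g)) (I h) x).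

Definition same_subscheme (I I' : P -> KE -> Prop) : Prop :=
  forall h x, basic_open h -> I h x <-> I' h x.

(* C[eps]-bilinear maps N x (S / I) -> Z. *)
Definition bilinear_map (S I : KE -> Prop) (N Z : lmodType A)
    (b : N -> KE -> Z) : Prop :=
  [/\ forall a u v x, S x -> b (a *: u + v) x = a *: b u x + b v x,
      forall a u x y, S x -> S y ->
        b u (constant_eps a * x + y) = a *: b u x + b u y
    & forall u x, I x -> b u x = 0].

(* The sum of the pure tensors u (x) [x], for (u, x) in t, is zero in the     *)
(* tensor product N (x) (S / I) over C[eps].                                  *)
Definition tensor_zero (S I : KE -> Prop) (N : lmodType A)
    (t : seq (N * KE)) : Prop :=
  forall (Z : lmodType A) (b : N -> KE -> Z), bilinear_map S I b ->
    \sum_(z <- t) b z.1 z.2 = 0.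

(* S / I is a flat C[eps]-module: - (x) (S / I) preserves injectivity. *)
Definition flat_quotient (S I : KE -> Prop) : Prop :=
  forall (N N' : lmodType A) (phi : {linear N -> N'}), injective phi ->
  forall t : seq (N * KE), (forall z, z \in t -> S z.2) ->
    tensor_zero S I [seq (phi z.1, z.2) | z <- t] -> tensor_zero S I t.

Definition first_order_deformation (I : P -> KE -> Prop) : Prop :=
  [/\ closed_subscheme I,
      forall h, basic_open h -> flat_quotient (regular_eps h) (I h)
    & forall h x, basic_open h ->
        vanishing h 0 x <-> exists y, I h (x, y)].

(* The ideal of the trivial deformation of X over D+(h). *)
Definition trivial_ideal (h : P) (x : KE) : Prop :=
  vanishing h 0 x.1 /\ vanishing h 0 x.2.

(* Over D+(h), the subscheme I is isomorphic to the trivial deformation: theta *)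
(* induces an isomorphism of C[eps]-algebras between the coordinate rings     *)
(* which is the identity on the closed fibre.                                 *)
Definition trivial_over (h : P) (I : P -> KE -> Prop) : Prop :=
  let S := regular_eps h in
  let T := trivial_ideal h in
  exists theta : KE -> KE,
    [/\ forall x, S x -> S (theta x),
        [/\ forall x y, S x -> S y -> T (theta (x + y) - (theta x + theta y)),
            forall x y, S x -> S y -> T (theta (x * y) - theta x * theta y)
          & forall a : A, T (theta (constant_eps a) - constant_eps a)],
        forall x, S x -> (I h x <-> T (theta x)),
        forall y, S y -> exists2 x, S x & T (theta x - y)
      & forall x, S x -> vanishing h 0 (theta x - x).1].

Definition locally_trivial_deformation (I : P -> KE -> Prop) : Prop :=
  first_order_deformation I /\
  forall p, proj_point p -> p f ->
    exists2 h, basic_open h /\ ~ p h & trivial_over h I.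

(* The subscheme f + eps * s = 0 defined by a section s of N_X. *)
Definition deformation_of (s : P -> K) (h : P) (x : KE) : Prop :=
  exists u v : K, [/\ twist h (- d%:Z) u, twist h (- d%:Z) v
    & x = ((u, v) : KE) * ((ofpoly f, s h) : KE)].

(* The section of O(d) defined by a form of degree d. *)
Definition form_section (g : P) : P -> K := fun _ => ofpoly g.

End Geometry.

(* Main.v *)
Require Import Defs.
From HB Require Import structures.
From mathcomp Require Import all_boot all_order all_algebra.
From mathcomp Require Import functions reals complex mpoly.
From mathcomp Require Import boolp classical_sets generic_quotient.
From mathcomp Require Import ring zify.

Set Implicit Arguments.
Unset Strict Implicit.
Unset Printing Implicit Defensive.

Import GRing.Theory.
Local Open Scope ring_scope.

(** Write S for the functions on D+(h) and I_X for the ideal of X there, which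
    is f O(-d).  Everything takes place in the function field of affine space,
    where the sections of O(k) over D+(h) form the degree k part of P[1/h].

    Deformations are normal sections.  Let I be the ideal over D+(h) of a first
    order deformation.  By flatness, I meets eps S in eps I_X
    ([flat_closed_fibre]); so I is the graph of an S-linear map from I_X to
    S/I_X.  As O(-d) is invertible, such a map is u f |-> u s for a section s
    of O(d), unique modulo f ([local_equation], [same_deformation]).
    Conversely the ideal generated by f + eps s has a flat quotient, because a
    C-linear lift of S/I_X makes this quotient free over C[eps]
    ([deformation_flat]).

    Local triviality is the local existence of vector fields.  A vector field D
    with image s gives the automorphism 1 - eps D, which trivializes the
    deformation ([trivial_over_deformation]).  A trivialization gives back a
    derivation D with D (u f) = u s, but only modulo I_X.  The chain rule for
    f(c X_0, ..., c X_r) = c^d f, with c of degree -1, shows that the honest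
    derivation with coefficients D (c X_j) / c has the same effect on f
    ([local_form]).  In the same way, the sections of N'_X are those which are
    locally of the form sum_j a_j f_j modulo f, where the a_j are sections of
    O(1) and f_j is the partial derivative of f ([H0_N'_derivation]).

    Comparison with the jacobian ring.  The two cohomological inputs are
    consequences of H^1(P^r, O) = 0 for r >= 2 ([cech_H1]): every section of
    O_X(d) comes from a form g of degree d ([normal_section_polynomial]), and
    every vector field on P^r is sum_j a_j d/dX_j with linear forms a_j
    ([global_vector_field_linear]).  The first one reduces the claim to forms:
    g is locally a combination of the f_j if and only if it lies in the
    saturation of J(f).  Indeed an identity X_i^M g = sum_j a_j f_j provides a
    vector field over D+(X_i), and conversely the ideal of the multipliers that
    bring powers of X_i times g into J(f) is contained in no point of Proj
    outside X_i = 0, hence is the unit ideal ([H0_N'_saturated]).  The second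
    one identifies the forms that come from H^0(P^r, T): they are those of
    J(f) + (f), and f belongs to J(f) by Euler's identity
    ([image_form_jacobian]). *)

(** * Consequences of Zorn's lemma *)

(** Keeping A0 below every member makes A0 itself the bound of the empty
    chain: Zorn's lemma for inclusion is applied to the sets A such that P
    holds of A0 union A. *)
Lemma Zorn_above (T : Type) (P : (T -> Prop) -> Prop) (A0 : T -> Prop) :
    P A0 ->
    (forall F : (T -> Prop) -> Prop, (exists X, F X) ->
       (forall X, F X -> P X) ->
       (forall X Y, F X -> F Y ->
          (forall t, X t -> Y t) \/ (forall t, Y t -> X t)) ->
       P (fun t => exists2 X, F X & X t)) ->
  exists A, [/\ P A, forall t, A0 t -> A t
              & forall B, P B -> (forall t, A t -> B t) ->
                  forall t, B t -> A t].
Proof.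
move=> PA0 Pchain.
pose PU (A : set T) := P (fun t => A0 t \/ A t).
have extE (X Y : T -> Prop) : (forall t, X t <-> Y t) -> X = Y.
  by move=> XY; apply/funext=> t; apply/propext.
have [F FP Ftot|A [PA Amax]] := @Zorn_bigcup T PU.
  have [[X0 FX0]|noF] := pselect (exists X, F X); last first.
    rewrite /PU (_ : (fun t => _) = A0) //; apply: extE => t.
    by split=> [[//|[X FX]]|]; [case: noF; exists X | left].
  pose F' (Y : T -> Prop) := exists2 X, F X & Y = (fun t => A0 t \/ X t).
  rewrite /PU; have -> : (fun t => A0 t \/ (\bigcup_(X in F) X)%classic t) =
            (fun t => exists2 Y, F' Y & Y t).
    apply: extE => t; split=> [[A0t|[X FX Xt]]|[_ [X FX ->] [|Xt]]].
    - by exists (fun t => A0 t \/ X0 t); [exists X0 | left].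
    - by exists (fun t => A0 t \/ X t); [exists X | right].
    - by left.
    - by right; exists X.
  apply: Pchain => [|_ [X FX ->]|_ _ [X FX ->] [Y FY ->]].
  - by exists (fun t => A0 t \/ X0 t); exists X0.
  - exact: FP.
  - by case: (Ftot X Y FX FY) => XY; [left|right] => t [|/XY]; by [left|right].
exists (fun t => A0 t \/ A t); split=> [//|t|B PB AB t Bt]; first by left.
apply: contrapT => nAt; apply: (Amax B).
  split=> [u Au|BA]; first by apply: AB; right.
  by apply: nAt; right; apply: BA.
rewrite /PU (_ : (fun t => _) = B) //; apply: extE => u.
by split=> [[A0u|//]|]; [apply: AB; left | right].
Qed.

Section LinearExtension.
Variables (F : fieldType) (V W : lmodType F).

(** The graphs of the linear maps which extend g, are defined on a subspace
    and take their values in W0 are stable under unions of chains. A maximal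
    one is defined everywhere, since it can be prolonged by 0 to any further
    vector. The bound W0 keeps an extension within, say, the regular functions
    or the ideal of X. *)
Lemma linear_extension (U : V -> Prop) (W0 : W -> Prop) (g : V -> W) :
    subspace U -> subspace W0 ->
    (forall a u v, U u -> U v -> g (a *: u + v) = a *: g u + g v) ->
    (forall u, U u -> W0 (g u)) ->
  exists l : V -> W,
    [/\ forall a u v, l (a *: u + v) = a *: l u + l v,
        forall u, U u -> l u = g u & forall v, W0 (l v)].
Proof.
move=> [U0 Ulin] [W00 W0lin] glin gW0.
pose P (G : V * W -> Prop) :=
  [/\ G (0, 0), forall a x y, G x -> G y -> G (a *: x + y),
      forall w, G (0, w) -> w = 0 & forall x, G x -> W0 x.2].
pose G0 (x : V * W) := U x.1 /\ x.2 = g x.1.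
have g0 : g 0 = 0.
  have := glin 1 0 0 U0 U0; rewrite !scale1r addr0 => /eqP.
  by rewrite -subr_eq0 opprD addNKr oppr_eq0 => /eqP.
have [||G [[G00 Glin Gfun GW0] G0G Gmax]] := @Zorn_above _ P G0.
- split=> [|a [u v] [u' v'] [/= Uu ->] [/= Uu' ->]|w [_ /= ->]|[u v] [/= Uu ->]] //.
  + by split=> /=; [exact: Ulin | rewrite glin].
  + exact: gW0.
- move=> FF [X FX] FP Ftot; split.
  + by exists X => //; case: (FP _ FX).
  + move=> a x y [Y FY Yx] [Z FZ Zy].
    case: (Ftot _ _ FY FZ) => YZ.
      by exists Z => //; case: (FP _ FZ) => _ + _ _; apply=> //; apply: YZ.
    by exists Y => //; case: (FP _ FY) => _ + _ _; apply=> //; apply: YZ.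
  + by move=> w [Y FY]; case: (FP _ FY) => _ _ + _; apply.
  + by move=> x [Y FY]; case: (FP _ FY) => _ _ _; apply.
have Gdom v : exists w, G (v, w).
  apply: contrapT => nGv.
  pose G' (x : V * W) := exists c y, G y /\ x = (y.1 + c *: v, y.2).
  have PG' : P G'.
    split.
    - by exists 0, (0, 0); split=> //=; rewrite scale0r addr0.
    - move=> a _ _ [c [y [Gy ->]]] [c' [y' [Gy' ->]]].
      exists (a * c + c'), (a *: y + y'); split; first exact: Glin.
      congr pair => /=.
      by rewrite scalerDr scalerDl scalerA addrACA.
    - move=> w [c [[y z] [Gy [/= /esym/eqP yE ->]]]].
      have [c0|c0] := eqVneq c 0.
        move: yE; rewrite c0 scale0r addr0 => /eqP y0; rewrite y0 in Gy.
        exact: Gfun.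
      case: nGv; exists (- c^-1 *: z).
      have := Glin (- c^-1) _ _ Gy G00; congr G; congr pair => /=; last by rewrite addr0.
      move: yE; rewrite addr_eq0 => /eqP ->.
      by rewrite scalerN scaleNr opprK scalerA mulVf // scale1r addr0.
    - by move=> _ [c [y [Gy ->]]]; apply: (GW0 y).
  case: nGv; exists 0; apply: (Gmax G' PG').
    by move=> y Gy; exists 0, y; split=> //; rewrite scale0r addr0; case: (y).
  by exists 1, (0, 0); split=> //=; rewrite scale1r add0r.
have Gfun2 v w w' : G (v, w) -> G (v, w') -> w = w'.
  move=> Gw Gw'; apply/eqP; rewrite -subr_eq0; apply/eqP/Gfun.
  have := Glin (-1) _ _ Gw' Gw; congr G; congr pair => /=.
    by rewrite scaleN1r addrC subrr.
  by rewrite scaleN1r addrC.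
pose l v := projT1 (cid (Gdom v)).
have lG v : G (v, l v) by rewrite /l; case: cid.
exists l; split=> [a u v|u Uu|v].
- by apply: (Gfun2 (a *: u + v)) => //; apply: (Glin a _ _ (lG u) (lG v)).
- by apply: (Gfun2 u) => //; apply: G0G.
- exact: (GW0 _ (lG v)).
Qed.

End LinearExtension.

Definition ideal_pred (A : comNzRingType) (I : A -> Prop) : Prop :=
  I 0 /\ forall a b c, I a -> I b -> I (c * a + b).

(** An ideal p maximal among those that contain I and no power of x is prime:
    for a and b outside p, the ideals p + (a) and p + (b) contain powers of x,
    whose product lies in p + (ab). *)
Lemma prime_avoiding_powers (A : comNzRingType) (I : A -> Prop) (x : A) :
    ideal_pred I -> (forall k, ~ I (x ^+ k)) ->
  exists p : A -> Prop, [/\ ideal_pred p, forall a, I a -> p a, ~ p x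
    & forall a b, p (a * b) -> p a \/ p b].
Proof.
move=> idI Ix.
pose P (J : A -> Prop) := ideal_pred J /\ forall k, ~ J (x ^+ k).
have [//|FF [X FX] FP Ftot|p [[[p0 plin] px] Ip pmax]] := @Zorn_above _ P I.
  split.
    split; first by exists X => //; case: (FP _ FX) => -[].
    move=> a b c [Y FY Ya] [Z FZ Zb].
    case: (Ftot _ _ FY FZ) => YZ.
      exists Z => //; case: (FP _ FZ) => -[_ +] _; apply=> //; exact: YZ.
    exists Y => //; case: (FP _ FY) => -[_ +] _; apply=> //; exact: YZ.
  by move=> k [Y FY]; case: (FP _ FY) => _; apply.
have grow a : ~ p a -> exists k c b, p b /\ x ^+ k = c * a + b.
  move=> npa; apply: contrapT => nex.
  pose q b := exists c b', p b' /\ b = c * a + b'.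
  apply: npa; apply: (pmax q); last by exists 1, 0; rewrite mul1r addr0.
    split; last by move=> k [c [b [pb E]]]; apply: nex; exists k, c, b.
    split; first by exists 0, 0; rewrite mul0r addr0.
    move=> _ _ e [c [b [pb ->]]] [c' [b' [pb' ->]]].
    exists (e * c + c'), (e * b + b'); split; [exact: plin|ring].
  by move=> b pb; exists 0, b; rewrite mul0r add0r.
exists p; split=> // [px1|a b pab]; first by apply: (px 1); rewrite expr1.
have [pa|npa] := pselect (p a); first by left.
have [pb|npb] := pselect (p b); first by right.
have [k [c [u [pu E]]]] := grow _ npa.
have [k' [c' [u' [pu' E']]]] := grow _ npb.
case: (px (k + k')%N); rewrite exprD E E'.
have -> : (c * a + u) * (c' * b + u') =
   (c * c') * (a * b) + ((c' * b + u') * u + (c * a * u')) by ring.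
by apply: (plin) => //; apply: (plin) => //; rewrite -[_ * u']addr0; apply: (plin).
Qed.

(** * Homogeneous polynomials and the jacobian ideal *)

Section Polynomials.
Variables (F : fieldType) (n : nat).
Implicit Types (p q : {mpoly F[n]}) (i j : 'I_n).

Lemma pihomogM e (a : {mpoly F[n]}) k p : a \is e.-homog ->
  pihomog mdeg (e + k)%N (a * p) = a * pihomog mdeg k p.
Proof.
move=> ha; rewrite {1}(pihomog_partitionE (leqnn (mmeasure mdeg p))).
rewrite [in RHS](pihomog_partitionE (leqnn (mmeasure mdeg p))).
rewrite mulr_sumr !linear_sum /= mulr_sumr; apply: eq_bigr => l _.
have hl := pihomogP mdeg l p; have [<-|nkl] := eqVneq (l : nat) k.
  by rewrite (pihomog_dE hl) (pihomog_dE (dhomogM ha hl)).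
rewrite (pihomog_ne0 nkl hl) mulr0 (pihomog_ne0 _ (dhomogM ha hl)) //.
by rewrite eqn_add2l.
Qed.

Lemma pihomogM_small e (a : {mpoly F[n]}) k p : a \is e.-homog -> (k < e)%N ->
  pihomog mdeg k (a * p) = 0.
Proof.
move=> ha ke; rewrite (pihomog_partitionE (leqnn (mmeasure mdeg p))).
rewrite mulr_sumr linear_sum /= big1 // => l _.
apply: pihomog_ne0 (dhomogM ha (pihomogP mdeg l p)).
by rewrite gtn_eqF // ltn_addr.
Qed.

Lemma pihomog_mul N p q D : (mmeasure mdeg p <= D)%N ->
  pihomog mdeg N (p * q) =
  \sum_(l < D | (l <= N)%N) pihomog mdeg l p * pihomog mdeg (N - l)%N q.
Proof.
move=> pD; rewrite [in LHS](pihomog_partitionE pD) mulr_suml linear_sum /=.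
rewrite [RHS]big_mkcond; apply: eq_bigr => l _; case: leqP => lN.
  by have := pihomogM (N - l)%N q (pihomogP mdeg l p); rewrite subnKC.
by rewrite (pihomogM_small _ (pihomogP _ _ _)).
Qed.

Lemma monomial_factor p (u : 'X_{1..n}) :
  (forall m, m \in msupp p -> (u <= m)%MM) -> exists q, p = 'X_[u] * q.
Proof.
move=> le_um; exists (\sum_(m <- msupp p) p@_m *: 'X_[m - u]).
rewrite {1}[p]mpolyE mulr_sumr !big_seq; apply: eq_bigr => m /le_um mu.
by rewrite -scalerAr -mpolyXD addmC submK.
Qed.

Lemma supp_monomial_multiple (u m : 'X_{1..n}) q :
  ('X_[u] * q)@_m != 0 -> (u <= m)%MM.
Proof.
rewrite mulrC -mcoeff_msupp (perm_mem (msuppMX _ _)) => /mapP[m' _ ->].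
by rewrite lem_addr.
Qed.

Lemma le_pow_mnm i a (m : 'X_{1..n}) : (U_(i) *+ a <= m)%MM = (a <= m i)%N.
Proof.
apply/mnm_lepP/idP => [/(_ i)|am j].
  by rewrite mulmnE mnm1E eqxx mul1n.
by rewrite mulmnE mnm1E; case: eqP => [<-|_]; rewrite ?mul1n ?mul0n.
Qed.

Lemma coef_pow_shift k c p (m : 'X_{1..n}) :
  ('X_k ^+ c * p)@_(m + U_(k) *+ c) = p@_m.
Proof. by rewrite mpolyXn mulrC addmC mcoeffMX. Qed.

(** X_k is a nonzerodivisor modulo (X_i^a, X_j^b). Membership in an ideal
    generated by monomials is tested on each monomial, and multiplication by
    X_k^c changes neither the exponent of X_i nor that of X_j. *)
Lemma mem_variable_ideal i j k a b c p q r : k != i -> k != j ->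
    'X_k ^+ c * p = 'X_i ^+ a * q + 'X_j ^+ b * r ->
  exists q' r', p = 'X_i ^+ a * q' + 'X_j ^+ b * r'.
Proof.
move=> ki kj E.
pose p1 := \sum_(m <- msupp p | (a <= m i)%N) p@_m *: 'X_[m].
pose p2 := \sum_(m <- msupp p | ~~ (a <= m i)%N) p@_m *: 'X_[m].
have pE : p = p1 + p2 by rewrite {1}[p]mpolyE (bigID (fun m : 'X_{1..n} => a <= m i)%N).
have supp_sum (Q : pred 'X_{1..n}) m :
    m \in msupp (\sum_(m <- msupp p | Q m) p@_m *: 'X_[m]) ->
    Q m && (p@_m != 0).
  rewrite mcoeff_msupp raddf_sum /=; case: (boolP (Q m && _)) => // nQ.
  rewrite big_seq_cond big1 ?eqxx // => m' /andP[m'p Qm'].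
  rewrite mcoeffZ mcoeffX; case: eqP => [mm'|_]; last by rewrite mulr0.
  by move: nQ; rewrite -mm' Qm' /= negbK => /eqP->; rewrite mul0r.
have [q' q'E] : exists q', p1 = 'X_i ^+ a * q'.
  rewrite mpolyXn; apply: monomial_factor => m /supp_sum /andP[am _].
  by rewrite le_pow_mnm.
have [r' r'E] : exists r', p2 = 'X_j ^+ b * r'.
  rewrite mpolyXn; apply: monomial_factor => m /supp_sum /andP[am pm].
  rewrite le_pow_mnm; have := congr1 (mcoeff (m + U_(k) *+ c)%MM) E.
  rewrite coef_pow_shift mcoeffD => pmE.
  have /negbNE/eqP q0 : ~~ (('X_i ^+ a * q)@_(m + U_(k) *+ c) != 0).
    apply/negP; rewrite mpolyXn => /supp_monomial_multiple.
    rewrite le_pow_mnm mnmDE mulmnE mnm1E (negPf ki) mul0n addn0.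
    by rewrite (negPf am).
  move: pmE; rewrite q0 add0r => pmE; move: pm; rewrite pmE mpolyXn.
  move/supp_monomial_multiple.
  by rewrite le_pow_mnm mnmDE mulmnE mnm1E (negPf kj) mul0n addn0.
by exists q', r'; rewrite {1}pE q'E r'E.
Qed.

Lemma variable_pow_dvd i k a c p q : k != i ->
    'X_k ^+ c * p = 'X_i ^+ a * q -> exists q', p = 'X_i ^+ a * q'.
Proof.
move=> ki E.
have [|q' [r' ->]] := @mem_variable_ideal i i k a a c p q 0 ki ki.
  by rewrite mulr0 addr0.
by exists (q' + r'); rewrite mulrDr.
Qed.

Lemma var_homog i : ('X_i : {mpoly F[n]}) \is 1.-homog.
Proof. by rewrite dhomogX /= mdeg1. Qed.

Lemma dhomogXn i b : ('X_i ^+ b : {mpoly F[n]}) \is b.-homog.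
Proof. by rewrite -{2}[b]mul1n dhomogMn // var_homog. Qed.

Lemma homog_quotient l i a p q : p \is l.-homog -> p = 'X_i ^+ a * q ->
  exists2 q', q' \is (l - a).-homog & p = 'X_i ^+ a * q'.
Proof.
move=> hp pE; have [al|la] := leqP a l.
  exists (pihomog mdeg (l - a)%N q); first exact: pihomogP.
  by have := pihomogM (l - a) q (dhomogXn i a); rewrite subnKC // -pE (pihomog_dE hp).
exists 0; first exact: dhomog0.
by rewrite mulr0 -(pihomog_dE hp) {1}pE (pihomogM_small _ (dhomogXn i a)).
Qed.

Lemma homog0_constant p : p \is 0.-homog -> exists c, p = c%:MP.
Proof.
move=> hp; exists p@_0; apply/mpolyP => m; rewrite mcoeffC.
case: (m =P 0%MM) => [->|/eqP m0]; first by rewrite mulr1.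
by rewrite mulr0; apply: (dhomog_nemf_coeff hp); rewrite /= mdeg_eq0.
Qed.

Lemma mderiv_homog l i p : p \is l.-homog -> p^`M(i) \is l.-1.-homog.
Proof.
move=> /dhomogP hp; apply/dhomogP => m; rewrite mcoeff_msupp mcoeff_deriv => nz.
have /hp : (m + U_(i))%MM \in msupp p.
  by rewrite mcoeff_msupp; apply: contraNneq nz => ->; rewrite mul0rn.
by rewrite /= mdegD mdeg1 addn1 => <-.
Qed.

Lemma mderiv_homog0 i p : p \is 0.-homog -> p^`M(i) = 0.
Proof.
move=> /dhomogP hp; apply/mpolyP => m; rewrite mcoeff_deriv mcoeff0.
rewrite (_ : p@_(m + U_(i)) = 0) ?mul0rn //; apply/eqP/negbNE.
rewrite -mcoeff_msupp; apply/negP => /hp.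
by rewrite /= mdegD mdeg1 addn1.
Qed.

Lemma euler l p : p \is l.-homog -> \sum_(i < n) 'X_i * p^`M(i) = l%:R *: p.
Proof.
move=> /dhomogP hp.
have E i : 'X_i * p^`M(i) = \sum_(m <- msupp p) ((m i)%:R * p@_m) *: 'X_[m].
  rewrite {1}[p]mpolyE raddf_sum /= mulr_sumr; apply: eq_bigr => m _.
  rewrite mderivZ mderivX -!scalerAr scalerA mulrC.
  case mi: (m i) => [|l']; first by rewrite mul0r !scale0r.
  rewrite -mpolyXD addmC submK // -[U_(i)%MM]mulm1n.
  by rewrite le_pow_mnm mi.
rewrite (eq_bigr _ (fun i _ => E i)) exchange_big /= [in RHS](mpolyE p) scaler_sumr.
rewrite !big_seq; apply: eq_bigr => m /hp <-.
by rewrite -scaler_suml scalerA -mulr_suml -natr_sum /= mdegE.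
Qed.

Section Jacobian.
Variables (f : {mpoly F[n]}) (d : nat).
Hypothesis hf : f \is d.-homog.

Lemma jacobian_idealP : ideal_pred (jacobian_ideal f).
Proof.
split=> [|a b c [u ->] [v ->]].
  by exists (fun=> 0); rewrite big1 // => i _; rewrite mul0r.
exists (fun i => c * u i + v i); rewrite mulr_sumr -big_split /=.
by apply: eq_bigr => i _; rewrite mulrDl mulrA.
Qed.

Lemma jacobian_pihomog k g : jacobian_ideal f g ->
  jacobian_ideal f (pihomog mdeg k g).
Proof.
move=> [a ->]; have [dk|kd] := leqP d.-1 k.
  exists (fun i => pihomog mdeg (k - d.-1)%N (a i)).
  rewrite linear_sum /=; apply: eq_bigr => i _.
  have := pihomogM (k - d.-1) (a i) (mderiv_homog i hf).
  by rewrite subnKC // mulrC => ->; rewrite mulrC.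
rewrite linear_sum /= big1; first by case: jacobian_idealP.
by move=> i _; rewrite mulrC (pihomogM_small _ (mderiv_homog i hf)).
Qed.

Lemma jacobian_homog_coef k g : (d.-1 <= k)%N -> g \is k.-homog ->
    jacobian_ideal f g ->
  exists2 a : 'I_n -> {mpoly F[n]}, forall i, a i \is (k - d.-1).-homog
    & g = \sum_(i < n) a i * f^`M(i).
Proof.
move=> dk /pihomog_dE hg [a gE].
exists (fun i => pihomog mdeg (k - d.-1)%N (a i)); first by move=> i; exact: pihomogP.
rewrite -{1}hg {1}gE linear_sum /=; apply: eq_bigr => i _.
have := pihomogM (k - d.-1) (a i) (mderiv_homog i hf).
by rewrite subnKC // mulrC => ->; rewrite mulrC.
Qed.

Lemma mem_jacobian : d%:R != 0 :> F -> jacobian_ideal f f.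
Proof.
move=> d0; exists (fun i => d%:R^-1 *: 'X_i).
under eq_bigr do rewrite -scalerAl.
by rewrite -scaler_sumr (euler hf) scalerA mulVf // scale1r.
Qed.

End Jacobian.

(** The polynomials whose homogeneous components all lie in a prime ideal q
    form a homogeneous prime: if a_s and b_t are the lowest components of a
    and b outside q, then the component of degree s + t of ab is a_s b_t
    modulo q. *)
Lemma homogeneous_prime_avoiding (I : {mpoly F[n]} -> Prop) i :
    ideal_pred I -> (forall a k, I a -> I (pihomog mdeg k a)) ->
    (forall k, ~ I ('X_i ^+ k)) ->
  exists p : {mpoly F[n]} -> Prop, [/\ proj_point p, forall a, I a -> p a & ~ p 'X_i].
Proof.
move=> idI homI IX.
have [q [[q0 qlin] Iq qX qprime]] := prime_avoiding_powers idI IX.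
have qD a b : q a -> q b -> q (a + b) by rewrite -{2}[a]mul1r; exact: (qlin).
have qM c a : q a -> q (c * a).
  by move=> qa; rewrite -[_ * _]addr0; apply: (qlin).
have qsum (J : finType) (P : pred J) (G : J -> {mpoly F[n]}) :
   (forall l, P l -> q (G l)) -> q (\sum_(l | P l) G l).
  by move=> qG; elim/big_ind: _.
have q1 : ~ q 1 by move=> q1; apply: qX; rewrite -[X in q X]mulr1; apply: qM.
pose p (a : {mpoly F[n]}) := forall k, q (pihomog mdeg k a).
have pM a c : p a -> p (c * a).
  move=> pa k; rewrite (pihomog_mul _ _ (leqnn _)).
  by apply: qsum => l _; apply: qM.
have nX : ~ p 'X_i by move/(_ 1%N); rewrite pihomog_dE // dhomogX /= mdeg1.
exists p; split=> //; last by move=> a Ia k; apply/Iq/homI.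
split.
- split=> [k|a b c pa pb k]; first by rewrite raddf0.
  by rewrite linearD; apply: qD; [apply: pM | apply: pb].
- split=> [/(_ 0%N)|a b pab].
    by rewrite pihomog_dE // dhomog1.
  have lowest c : ~ p c -> exists s, ~ q (pihomog mdeg s c) /\
      forall l, (l < s)%N -> q (pihomog mdeg l c).
    move=> npc.
    have /existsNP[s0 ns0] : ~ (forall k, q (pihomog mdeg k c)) by [].
    have ex : exists s, ~~ `[< q (pihomog mdeg s c) >].
      by exists s0; apply/asboolPn.
    case: (ex_minnP ex) => s /asboolPn ns smin; exists s; split=> // l ls.
    apply: contrapT => nq; have /smin : ~~ `[< q (pihomog mdeg l c) >].
      exact/asboolPn.
    by rewrite leqNgt ls.
  apply: contrapT => /not_orP[/lowest[s [ns smin]] /lowest[t [nt tmin]]].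
  have D : (s < (mmeasure mdeg a + s.+1))%N by rewrite addnS ltnS leq_addl.
  have := pab (s + t)%N; rewrite (@pihomog_mul _ _ _ _ (leq_addr s.+1 _)).
  rewrite (bigD1 (Ordinal D)) ?leq_addr //= addKn => qst.
  suff /qprime[] : q (pihomog mdeg s a * pihomog mdeg t b) by [].
  set A := _ * _ in qst *; set B := \sum_(_ | _) _ in qst.
  have -> : A = -1 * B + (A + B) by rewrite mulN1r addrC addrK.
  apply: (qlin) => //; apply: qsum => l /andP[lst ls].
  case: (ltngtP l s) => [/smin ql|sl|E].
  - by rewrite mulrC; apply: qM.
  - by apply: qM; apply: tmin; rewrite ltn_subLR // ltn_add2r.
  - by case/eqP: ls; apply: val_inj.
- move=> a k pa l; have [->|kl] := eqVneq k l; first by rewrite pihomog_id.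
  by rewrite (pihomog_ne0 kl (pihomogP _ _ _)).
- by exists i.
Qed.

End Polynomials.

(** * Sections of O(k) as rational functions *)

Section RationalFunctions.
Variables (C : fieldType) (n : nat).
Local Notation P := {mpoly C[n]}.
Local Notation K := (ratfun C n).
Local Notation of_poly := (@ofpoly C n).

HB.instance Definition _ := GRing.RMorphism.copy of_poly (@FracField.tofrac P).

Lemma ofpoly_eq0 (p : P) : (ofpoly p == 0) = (p == 0).
Proof. exact: tofrac_eq0. Qed.

Lemma ofpoly_neq0 (p : P) : p != 0 -> ofpoly p != 0.
Proof. by rewrite ofpoly_eq0. Qed.

Lemma ofpoly_inj : injective of_poly.
Proof. by move=> p q /eqP; rewrite tofrac_eq => /eqP. Qed.

Lemma ratfun_scaleE (c : C) (x : K) : c *: x = ofpoly c%:MP * x.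
Proof. by []. Qed.

Lemma ratfun_frac (x : K) :
  exists u : P * P, u.2 != 0 /\ x = ofpoly u.1 / ofpoly u.2.
Proof.
elim/quotW: (x : {fraction P}) => r.
exists (frac r); split; first exact: denom_ratioP.
have r2 : (frac r).2 != 0 := denom_ratioP r.
rewrite -[r in LHS]Ratio_numden.
have -> : ofpoly (frac r).1 / ofpoly (frac r).2 =
  FracField.mul (FracField.tofrac (frac r).1)
    (FracField.inv (FracField.tofrac (frac r).2)) by [].
rewrite !piE; apply/eqmodP; rewrite /= FracField.equivfE.
by rewrite /FracField.mulf /FracField.invf !numden_Ratio ?mulr1 ?mul1r ?oner_neq0 // mulrC.
Qed.

(** Degrees of numerators are integers k + j e that can be negative, in which
    case the numerator is 0. *)
Definition zhomog (k : int) (p : P) : Prop :=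
  forall m, m \in msupp p -> (mdeg m)%:Z = k.

Lemma zhomog_dhomog (l : nat) (p : P) : p \is l.-homog <-> zhomog l%:Z p.
Proof.
split=> [/dhomogP hp m /hp <-|hp] //.
by apply/dhomogP => m /hp /eqP; rewrite eqz_nat => /eqP.
Qed.

Lemma zhomog_nat k (p : P) : zhomog k p -> p != 0 ->
  exists2 l : nat, k = l%:Z & p \is l.-homog.
Proof.
move=> hp p0; have m : mlead p \in msupp p by rewrite mlead_supp.
by exists (mdeg (mlead p)); [rewrite (hp _ m) | apply/zhomog_dhomog; rewrite (hp _ m)].
Qed.

Lemma zhomog0 k : zhomog k 0.
Proof. by move=> m; rewrite msupp0. Qed.

Lemma zhomogD k (p q : P) : zhomog k p -> zhomog k q -> zhomog k (p + q).
Proof.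
by move=> hp hq m /msuppD_le; rewrite mem_cat => /orP[/hp|/hq].
Qed.

Lemma zhomogN k (p : P) : zhomog k p -> zhomog k (- p).
Proof. by move=> hp m; rewrite (perm_mem (msuppN p)); exact: hp. Qed.

Lemma zhomogM k l (p q : P) : zhomog k p -> zhomog l q -> zhomog (k + l) (p * q).
Proof.
move=> hp hq m /msuppM_le/allpairsP[[m1 m2] [/= /hp <- /hq <- ->]].
by rewrite mdegD PoszD.
Qed.

Lemma zhomogC (c : C) : zhomog 0 c%:MP.
Proof.
apply/(zhomog_dhomog 0); rewrite -[c%:MP]mulr1 mul_mpolyC.
exact/dhomogZ/dhomog1.
Qed.

Lemma zhomogXn k j (p : P) : zhomog k p -> zhomog (j%:Z * k) (p ^+ j).
Proof.
move=> hp; elim: j => [|j IH]; first by rewrite mul0r expr0 -mpolyC1; exact: zhomogC.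
by rewrite exprS (_ : _ * k = k + j%:Z * k); [exact: zhomogM | lia].
Qed.

Lemma zhomogX i : zhomog 1 ('X_i : P).
Proof. exact/(zhomog_dhomog 1)/var_homog. Qed.

Section Twist.
Variables (h : P) (e : nat).
Hypotheses (h0 : h != 0) (hh : h \is e.-homog).

(** The exponent of the denominator can be raised at will: this is what gives
    several sections a common denominator. *)
Lemma twist_den k x : twist h k x -> exists j0, forall j, (j0 <= j)%N ->
  exists2 p, zhomog (k + (j * e)%:Z) p & x = ofpoly p / ofpoly h ^+ j.
Proof.
move=> [p [e' [l [j0 [he' hp lE ->]]]]].
have {he' lE} lE : l%:Z = k + (j0 * e)%:Z by rewrite lE (dhomog_uniq h0 he' hh).
exists j0 => j jj; exists (p * h ^+ (j - j0)%N).
  rewrite (_ : k + _ = l%:Z + (j - j0)%N%:Z * e%:Z); last by rewrite lE; nia.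
  by apply: zhomogM; [exact/zhomog_dhomog | exact/zhomogXn/zhomog_dhomog].
rewrite rmorphM rmorphXn /= -{2}(subnKC jj) exprD -mulf_div.
by rewrite (divff (expf_neq0 _ (ofpoly_neq0 h0))) mulr1.
Qed.

(** A zero numerator of negative degree has to be rewritten with a larger
    exponent of h, which is where the alternative on e and k is used. *)
Lemma twist_intro_ge (k : int) j p x : (0 < e)%N || (0 <= k) ->
  zhomog (k + (j * e)%:Z) p -> x = ofpoly p / ofpoly h ^+ j -> twist h k x.
Proof.
move=> ek hp ->; have [p0|p0] := eqVneq p 0; last first.
  by have [l lE hpl] := zhomog_nat hp p0; exists p, e, l, j.
exists 0, e, (absz (k + (absz k * e)%:Z)), (absz k); split=> //; first exact: dhomog0.
  case/orP: ek => [e0|]; last by lia.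
  by have := leq_pmulr (absz k) e0; lia.
by rewrite p0 rmorph0 !mul0r.
Qed.

End Twist.

Lemma twist1_poly k x : twist (1 : P) k x -> exists2 p, zhomog k p & x = ofpoly p.
Proof.
move=> /(twist_den (oner_neq0 _) (dhomog1 _ _))[j /(_ _ (leqnn _))[p hp ->]].
by exists p; [rewrite muln0 addr0 in hp | rewrite rmorph1 expr1n divr1].
Qed.

Lemma basic_openX i : basic_open ('X_i : P).
Proof.
by split; [rewrite -msupp_eq0 msuppX | exists 1%N => //; exact: var_homog].
Qed.

Lemma basic_openM (h g : P) : basic_open h -> basic_open g -> basic_open (h * g).
Proof.
move=> [h0 [e e0 hh]] [g0 [e' e'0 hg]]; split; first by rewrite mulf_neq0.
by exists (e + e')%N; [rewrite addn_gt0 e0 | exact: dhomogM].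
Qed.

Lemma basic_open_neq0 (h : P) : basic_open h -> ofpoly h != 0.
Proof. by case=> /ofpoly_neq0. Qed.

Lemma basic_open_den (h : P) : basic_open h ->
  exists e : nat, [/\ (0 < e)%N, h \is e.-homog, h != 0,
    forall k x, twist h k x -> exists j0, forall j, (j0 <= j)%N ->
      exists2 p, zhomog (k + (j * e)%:Z) p & x = ofpoly p / ofpoly h ^+ j
  & forall k j p x, zhomog (k + (j * e)%:Z) p ->
      x = ofpoly p / ofpoly h ^+ j -> twist h k x].
Proof.
move=> [h0 [e e0 hh]]; exists e; split=> //; first exact: twist_den.
by move=> k j p x; apply: twist_intro_ge; rewrite ?e0.
Qed.

Section TwistTheory.
Variable h : P.
Hypothesis bh : basic_open h.

Lemma twist_poly k p : zhomog k p -> twist h k (ofpoly p).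
Proof.
have [e [e0 hh h0 _ intro]] := basic_open_den bh => hp.
by apply: (intro k 0%N p); rewrite ?mul0n ?addr0 // expr0 divr1.
Qed.

Lemma twist0 k : twist h k 0.
Proof. by rewrite -(rmorph0 of_poly); exact/twist_poly/zhomog0. Qed.

Lemma twistD k x y : twist h k x -> twist h k y -> twist h k (x + y).
Proof.
have [e [e0 hh h0 den intro]] := basic_open_den bh.
move=> /den[j1 Hx] /den[j2 Hy].
have [p hp ->] := Hx _ (leq_maxl j1 j2); have [q hq ->] := Hy _ (leq_maxr j1 j2).
apply: (intro k _ (p + q) _ (zhomogD hp hq)).
by rewrite rmorphD /= mulrDl.
Qed.

Lemma twistM k l x y : twist h k x -> twist h l y -> twist h (k + l) (x * y).
Proof.
have [e [e0 hh h0 den intro]] := basic_open_den bh.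
move=> /den[j1 /(_ _ (leqnn _))[p hp ->]] /den[j2 /(_ _ (leqnn _))[q hq ->]].
apply: (intro (k + l) (j1 + j2)%N (p * q)).
  by rewrite (_ : _ + _ = (k + (j1 * e)%:Z) + (l + (j2 * e)%:Z)); [exact: zhomogM | lia].
by rewrite rmorphM /= exprD mulf_div.
Qed.

Lemma twistC (c : C) : twist h 0 (ofpoly c%:MP).
Proof. exact/twist_poly/zhomogC. Qed.

Lemma twist1 : twist h 0 1.
Proof. by rewrite -(rmorph1 of_poly) -mpolyC1; exact: twistC. Qed.

Lemma twistZ k (c : C) x : twist h k x -> twist h k (c *: x).
Proof. by move=> hx; rewrite -[k]add0r; apply: twistM => //; exact: twistC. Qed.

Lemma twistN k x : twist h k x -> twist h k (- x).
Proof. by move=> hx; rewrite -scaleN1r; exact: twistZ. Qed.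

Lemma twistB k x y : twist h k x -> twist h k y -> twist h k (x - y).
Proof. by move=> hx hy; apply: twistD => //; exact: twistN. Qed.

Lemma twist_sum k (I : Type) (r : seq I) (Q : pred I) (G : I -> K) :
  (forall i, Q i -> twist h k (G i)) -> twist h k (\sum_(i <- r | Q i) G i).
Proof. by move=> hG; elim/big_ind: _ => //; [exact: twist0 | exact: twistD]. Qed.

Lemma twistXn k j x : twist h k x -> twist h (j%:Z * k) (x ^+ j).
Proof.
move=> hx; elim: j => [|j IH]; first by rewrite mul0r expr0; exact: twist1.
by rewrite exprS (_ : _ * k = k + j%:Z * k); [exact: twistM | lia].
Qed.

Lemma twist_inv e : h \is e.-homog -> twist h (- e%:Z) (ofpoly h)^-1.
Proof.
have [e' [e0 hh' h0 den intro]] := basic_open_den bh => hh.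
have {}hh' := dhomog_uniq h0 hh hh'; subst e'.
by apply: (intro _ 1%N 1); [rewrite mul1n addNr -mpolyC1; exact: zhomogC
  | rewrite rmorph1 div1r expr1].
Qed.

Lemma twist_var i : twist h 1 (ofpoly 'X_i).
Proof. exact/twist_poly/zhomogX. Qed.

Lemma twist_restr g k x : basic_open g -> twist h k x -> twist (h * g) k x.
Proof.
move=> bg; have [e [e0 hh h0 den intro]] := basic_open_den bh.
have [e' [e'0 hg g0 _ _]] := basic_open_den bg.
move=> /den[j /(_ _ (leqnn _))[p hp ->]].
apply: (@twist_intro_ge (h * g) (e + e')%N _ _ k j (p * g ^+ j)).
- by rewrite mulf_neq0.
- exact: dhomogM.
- by rewrite addn_gt0 e0.
- rewrite (_ : _ + _ = (k + (j * e)%:Z) + j%:Z * e'%:Z); last by lia.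
  by apply: zhomogM => //; apply/zhomogXn/zhomog_dhomog.
- rewrite !rmorphM !rmorphXn /= exprMn -mulf_div.
  by rewrite (divff (expf_neq0 _ (basic_open_neq0 bg))) mulr1.
Qed.

End TwistTheory.

Lemma twist_restrl (h g : P) k x : basic_open h -> basic_open g ->
  twist g k x -> twist (h * g) k x.
Proof. by move=> bh bg; rewrite mulrC; exact: twist_restr. Qed.

(** Sections over D+(h X_i) and D+(h X_j) that agree extend to D+(h), because
    powers of distinct variables are coprime. With h = 1 this says that a
    section over two of the standard open sets is a polynomial. *)
Lemma twist_cap (h : P) e (k : int) i j x : h != 0 -> h \is e.-homog ->
    (0 < e)%N || (0 <= k) -> i != j ->
    twist (h * 'X_i) k x -> twist (h * 'X_j) k x -> twist h k x.
Proof.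
move=> h0 hh ek ij.
have den u := @twist_den (h * 'X_u) (e + 1)%N
  (mulf_neq0 h0 (proj1 (basic_openX u))) (dhomogM hh (var_homog C u)).
move=> /den[a Hi] /den[b Hj].
have [p hp xp] := Hi _ (leq_maxl a b); have [q hq xq] := Hj _ (leq_maxr a b).
set N := maxn a b in hp hq xp xq.
have XN u : ofpoly ('X_u : P) ^+ N != 0.
  exact: expf_neq0 (basic_open_neq0 (basic_openX u)).
have HN := expf_neq0 N (ofpoly_neq0 h0).
have E : 'X_j ^+ N * p = 'X_i ^+ N * q.
  apply: ofpoly_inj; rewrite !rmorphM !rmorphXn /=.
  move/eqP: xp; rewrite xq !rmorphM /= !exprMn.
  rewrite (eqr_div _ _ (mulf_neq0 HN (XN j)) (mulf_neq0 HN (XN i))).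
  move=> /eqP EE; apply: (mulfI HN).
  transitivity (ofpoly p * (ofpoly h ^+ N * ofpoly 'X_j ^+ N)); first by ring.
  by rewrite -EE; ring.
have [p' p'E] : exists p', p = 'X_i ^+ N * p'.
  by apply: variable_pow_dvd E; rewrite eq_sym.
have [p0|p0] := eqVneq p 0.
  clear HN XN; apply: (@twist_intro_ge _ _ h0 hh k 0%N 0 _ ek (@zhomog0 _)).
  by rewrite xp p0 !rmorph0 !mul0r.
have [l lE hl] := zhomog_nat hp p0.
have [p2 hp2 p2E] := homog_quotient hl p'E.
have p20 : p2 != 0 by apply: contraNneq p0 => E0; rewrite p2E E0 mulr0.
have lN : (N <= l)%N.
  rewrite leqNgt; apply/negP => lN; case/eqP: p0.
  by rewrite -(pihomog_dE hl) p2E (pihomogM_small _ (dhomogXn _ i N)).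
apply: (@twist_intro_ge _ _ h0 hh k N p2 _ ek).
  by rewrite (_ : _ + _ = (l - N)%N%:Z); [exact/zhomog_dhomog | nia].
rewrite xp p2E !rmorphM !rmorphXn /= exprMn.
rewrite [X in X / _]mulrC -mulf_div.
by rewrite (divff (XN i)) mulr1.
Qed.

End RationalFunctions.

(** * Derivations of the function field *)

Section Derivations.
Variables (C : fieldType) (n : nat).
Local Notation P := {mpoly C[n]}.
Local Notation K := (ratfun C n).
Local Notation of_poly := (@ofpoly C n).
Implicit Types (h p q : P) (x y : K).

(** These families witness that O(k) is invertible over D+(h). They make a
    linear map on O(-k) a multiplication by a section of O(k). *)
Definition unity_pairs h (k : int) (t : seq (K * K)) : Prop :=
  (forall z, z \in t -> twist h (- k) z.1 /\ twist h k z.2) /\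
  \sum_(z <- t) z.1 * z.2 = 1.

(** For k = 1, divide Euler's identity for h by deg(h) h; products of such
    families give all k. *)
Lemma unity_pairs_exist h (k : nat) : [pchar C] =i pred0 -> basic_open h ->
  exists t, unity_pairs h k t.
Proof.
move=> char0 bh; have [e [e0 hh _ den intro]] := basic_open_den bh.
have eC : e%:R != 0 :> C by rewrite ((pcharf0P C).1 char0) -lt0n.
have [t1 [Ht1 St1]] : exists t, unity_pairs h 1 t.
  exists [seq (ofpoly h^`M(i) / ofpoly h, e%:R^-1 *: ofpoly 'X_i : K) | i <- enum 'I_n].
  split=> [_ /mapP[i _ ->] /=|].
    split; last exact/twistZ/twist_var.
    apply: (intro _ 1%N h^`M(i)); last by rewrite expr1.
    rewrite mul1n (_ : - 1 + e%:Z = e.-1%:Z); last by lia.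
    by apply/zhomog_dhomog/mderiv_homog.
  rewrite big_map big_enum /=.
  transitivity (e%:R^-1 *: ((\sum_(i < n) ofpoly ('X_i * h^`M(i)) : K) / ofpoly h)).
    rewrite mulr_suml scaler_sumr; apply: eq_bigr => i _.
    by rewrite rmorphM /= !ratfun_scaleE; ring.
  rewrite -rmorph_sum (euler hh) /= -mul_mpolyC rmorphM /= -mulrA.
  rewrite (divff (basic_open_neq0 bh)) mulr1.
  by rewrite ratfun_scaleE -rmorphM -mpolyCM mulVf // mpolyC1 rmorph1.
elim: k => [|k [t [Ht St]]].
  exists [:: (1, 1)]; split=> [z|]; last by rewrite big_seq1 mulr1.
  by rewrite inE => /eqP-> /=; rewrite oppr0; split; exact: twist1.
exists [seq (z.1 * w.1, z.2 * w.2) | z <- t1, w <- t]; split.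
  move=> _ /allpairsP[[z w] [/= /Ht1[z1 z2] /Ht[w1 w2] ->]] /=.
  rewrite (_ : k.+1%:Z = 1 + k%:Z); last by lia.
  by rewrite (_ : - (1 + k%:Z) = - 1 + - k%:Z); [split; exact: twistM | lia].
rewrite big_allpairs_dep; transitivity
  ((\sum_(z <- t1) z.1 * z.2) * (\sum_(w <- t) w.1 * w.2)).
  rewrite big_distrlr /=; do 2!apply: eq_bigr => ? _; ring.
by rewrite St1 St mulr1.
Qed.

Definition fnum x : P := (projT1 (cid (ratfun_frac x))).1.
Definition fden x : P := (projT1 (cid (ratfun_frac x))).2.

Lemma fden_neq0 x : ofpoly (fden x) != 0.
Proof. by apply: ofpoly_neq0; rewrite /fden; case: cid => u []. Qed.

Lemma fnum_div_fden x : x = ofpoly (fnum x) / ofpoly (fden x).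
Proof. by rewrite /fnum /fden; case: cid => u []. Qed.

Definition fpartial (i : 'I_n) x : K :=
  (ofpoly (fnum x)^`M(i) * ofpoly (fden x) - ofpoly (fnum x) * ofpoly (fden x)^`M(i))
  / ofpoly (fden x) ^+ 2.

Lemma fpartial_frac i p q : q != 0 -> fpartial i (ofpoly p / ofpoly q) =
  (ofpoly p^`M(i) * ofpoly q - ofpoly p * ofpoly q^`M(i)) / ofpoly q ^+ 2.
Proof.
have quotient_rule (L : fieldType) (a b p' q' a1 b1 p1 q1 : L) :
    b != 0 -> q' != 0 -> p' / q' = a / b ->
    a1 * q' + a * q1 = p1 * b + p' * b1 ->
    (a1 * b - a * b1) / b ^+ 2 = (p1 * q' - p' * q1) / q' ^+ 2.
  move=> b0 q0 E E1; have pE : p' = a / b * q' by rewrite -E divfK.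
  have -> : p1 = (a1 * q' + a * q1 - p' * b1) / b by rewrite E1 addrK mulfK.
  by rewrite pE; field; rewrite b0 q0.
set x := (X in fpartial i X) => q0; rewrite /fpartial.
have E : ofpoly p / ofpoly q = ofpoly (fnum x) / ofpoly (fden x) :=
  fnum_div_fden x.
apply: (quotient_rule _ _ _ _ _ _ _ _ _ (fden_neq0 x) (ofpoly_neq0 q0) E).
have /(congr1 (mderiv i)) : fnum x * q = p * fden x.
  apply: ofpoly_inj; rewrite !rmorphM /=; apply/eqP; rewrite eq_sym.
  by rewrite -(eqr_div _ _ (ofpoly_neq0 q0) (fden_neq0 x)); apply/eqP.
by rewrite !mderivM => /(congr1 of_poly); rewrite !rmorphD !rmorphM.
Qed.

Lemma fpartial_poly i p : fpartial i (ofpoly p) = ofpoly p^`M(i).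
Proof.
rewrite -[ofpoly p]divr1 -(rmorph1 of_poly) (fpartial_frac _ _ (oner_neq0 _)).
have -> : 1^`M(i) = 0 :> P by rewrite -mpolyC1 mderivC.
rewrite rmorph0 rmorph1.
by rewrite mulr1 mulr0 subr0 expr1n divr1.
Qed.

Lemma fpartialD i x y : fpartial i (x + y) = fpartial i x + fpartial i y.
Proof.
have [[p q] [/= q0 ->]] := ratfun_frac x.
have [[r s] [/= s0 ->]] := ratfun_frac y.
rewrite (addf_div _ _ (ofpoly_neq0 q0) (ofpoly_neq0 s0)).
rewrite -!rmorphM -rmorphD !fpartial_frac ?mulf_neq0 // mderivD !mderivM.
rewrite !rmorphD !rmorphM /=.
have sum_rule (L : fieldType) (p' q' r' s' p1 q1 r1 s1 : L) :
    q' != 0 -> s' != 0 ->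
    ((p1 * s' + p' * s1 + (r1 * q' + r' * q1)) * (q' * s') -
     (p' * s' + r' * q') * (q1 * s' + q' * s1)) / (q' * s') ^+ 2 =
    (p1 * q' - p' * q1) / q' ^+ 2 + (r1 * s' - r' * s1) / s' ^+ 2.
  by move=> ? ?; field; apply/andP.
exact: sum_rule (ofpoly_neq0 q0) (ofpoly_neq0 s0).
Qed.

Lemma fpartialM i x y : fpartial i (x * y) = x * fpartial i y + y * fpartial i x.
Proof.
have [[p q] [/= q0 ->]] := ratfun_frac x.
have [[r s] [/= s0 ->]] := ratfun_frac y.
rewrite mulf_div -!rmorphM !fpartial_frac ?mulf_neq0 // !mderivM.
rewrite !rmorphD !rmorphM /=.
have product_rule (L : fieldType) (p' q' r' s' p1 q1 r1 s1 : L) :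
    q' != 0 -> s' != 0 ->
    ((p1 * r' + p' * r1) * (q' * s') - p' * r' * (q1 * s' + q' * s1))
      / (q' * s') ^+ 2 =
    p' / q' * ((r1 * s' - r' * s1) / s' ^+ 2) +
    r' / s' * ((p1 * q' - p' * q1) / q' ^+ 2).
  by move=> ? ?; field; apply/andP.
exact: product_rule (ofpoly_neq0 q0) (ofpoly_neq0 s0).
Qed.

Lemma fpartialZ i (c : C) x : fpartial i (c *: x) = c *: fpartial i x.
Proof.
by rewrite ratfun_scaleE fpartialM fpartial_poly mderivC rmorph0 mulr0 addr0.
Qed.

Lemma zhomog_mderiv k i p : zhomog k p -> zhomog (k - 1) p^`M(i).
Proof.
move=> hp m; rewrite mcoeff_msupp mcoeff_deriv => nz.
have /hp <- : (m + U_(i))%MM \in msupp p.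
  by rewrite mcoeff_msupp; apply: contraNneq nz => ->; rewrite mul0rn.
by rewrite mdegD mdeg1; lia.
Qed.

Lemma fpartial_twist h k i x : basic_open h -> twist h k x ->
  twist h (k - 1) (fpartial i x).
Proof.
move=> bh; have [e [e0 hh h0 den intro]] := basic_open_den bh.
move=> /den[j /(_ _ (leqnn _))[p hp ->]].
rewrite -rmorphXn (fpartial_frac _ _ (expf_neq0 j h0)) -!rmorphM -rmorphB /=.
have hhj : zhomog (j * e)%:Z (h ^+ j).
  by rewrite PoszM; apply/zhomogXn/zhomog_dhomog.
apply: (intro _ (j * 2)%N (p^`M(i) * h ^+ j - p * (h ^+ j)^`M(i))).
  have -> : k - 1 + (j * 2 * e)%:Z = (k + (j * e)%:Z - 1) + (j * e)%:Z by lia.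
  apply: zhomogD; first by apply: zhomogM => //; exact: zhomog_mderiv.
  apply: zhomogN.
  have -> : (k + (j * e)%:Z - 1) + (j * e)%:Z = (k + (j * e)%:Z) + ((j * e)%:Z - 1) by lia.
  by apply: zhomogM => //; exact: zhomog_mderiv.
by rewrite exprM rmorphXn.
Qed.

Definition der (a : 'I_n -> K) x : K := \sum_(i < n) a i * fpartial i x.

Lemma der_poly a p : der a (ofpoly p) = \sum_(i < n) a i * ofpoly p^`M(i).
Proof. by apply: eq_bigr => i _; rewrite fpartial_poly. Qed.

Lemma derM a x y : der a (x * y) = x * der a y + y * der a x.
Proof.
rewrite /der !mulr_sumr -big_split; apply: eq_bigr => i _ /=.
by rewrite fpartialM; ring.
Qed.

Lemma derP a (c : C) x y : der a (c *: x + y) = c *: der a x + der a y.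
Proof.
rewrite /der scaler_sumr -big_split; apply: eq_bigr => i _ /=.
by rewrite fpartialD fpartialZ !ratfun_scaleE; ring.
Qed.

Lemma der_twist h a k x : basic_open h -> (forall i, twist h 1 (a i)) ->
  twist h k x -> twist h k (der a x).
Proof.
move=> bh ha hx; apply: twist_sum => // i _.
have -> : k = 1 + (k - 1) by lia.
by apply: twistM => //; exact: fpartial_twist.
Qed.

Lemma der_vector_field h a : basic_open h -> (forall i, twist h 1 (a i)) ->
  vector_field h (der a).
Proof.
by move=> bh ha; split=> [x|c x y _ _|x y _ _];
  [exact: der_twist | exact: derP | exact: derM].
Qed.

(** This c turns the variables into functions c X_j on D+(h), without X_i in
    the denominator; over D+(h X_i) it is invertible, so that forms can be
    recovered. *)
Lemma variable_unit h e i : basic_open h -> (0 < e)%N -> h \is e.-homog ->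
  let c := ofpoly 'X_i ^+ e.-1 / ofpoly h : K in
  [/\ c != 0, twist h (- 1) c & twist (h * 'X_i) 1 c^-1].
Proof.
move=> bh e0 hh c; have bX := @basic_openX C n i; have bhX := basic_openM bh bX.
split.
- exact: mulf_neq0 (expf_neq0 _ (basic_open_neq0 bX)) (invr_neq0 (basic_open_neq0 bh)).
- rewrite (_ : - 1 = e.-1%:Z * 1 + - e%:Z); last by lia.
  by apply: twistM => //; [apply: twistXn => //; exact: twist_var | exact: twist_inv].
rewrite /c invfM invrK [X in twist _ _ X]mulrC -exprVn.
rewrite (_ : 1 = e%:Z + e.-1%:Z * - 1%:Z) //; last by lia.
apply: twistM => //; first exact/twist_poly/zhomog_dhomog.
by apply: twistXn => //; apply: twist_restrl => //;
  exact: (twist_inv bX (var_homog C i)).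
Qed.

End Derivations.

(** * The chain rule modulo a submodule *)

Section ChainRule.
Variables (C : fieldType) (n : nat).
Local Notation P := {mpoly C[n]}.
Local Notation K := (ratfun C n).
Local Notation of_poly := (@ofpoly C n).
Implicit Types (h p q : P) (x y : K).

Lemma mpoly_generated (R : P -> Prop) :
    (forall c, R c%:MP) -> (forall i, R 'X_i) ->
    (forall p q, R p -> R q -> R (p + q)) ->
    (forall p q, R p -> R q -> R (p * q)) ->
  forall p, R p.
Proof.
move=> RC RX RD RM p; rewrite [p]mpolyE.
elim/big_ind: _ => [||m _]; [by rewrite -mpolyC0|exact: RD|].
rewrite -mul_mpolyC; apply: (RM) => //; rewrite mpolyXE_id.
elim/big_ind: _ => [||i _]; [by rewrite -mpolyC1|exact: RM|].
by elim: (m i) => [|k IH]; [rewrite expr0 -mpolyC1 | rewrite exprS; apply: (RM)].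
Qed.

Definition constant_ratfun : C -> K := of_poly \o @mpolyC n C.
HB.instance Definition _ := GRing.RMorphism.on constant_ratfun.

Definition ev (z : 'I_n -> K) : P -> K := mmap constant_ratfun z.
HB.instance Definition _ z := GRing.RMorphism.on (ev z).

Lemma evC z c : ev z c%:MP = ofpoly c%:MP.
Proof. exact: mmapC. Qed.

Lemma evX z i : ev z 'X_i = z i.
Proof. by rewrite /ev mmapX mmap1U. Qed.

Lemma ev_homog (c : K) l p : p \is l.-homog ->
  ev (fun i => c * ofpoly 'X_i) p = c ^+ l * ofpoly p.
Proof.
move=> /dhomogP hp; rewrite /ev /mmap [in RHS](mpolyE p) rmorph_sum mulr_sumr /=.
rewrite !big_seq; apply: eq_bigr => m /hp /= <-.
rewrite -mul_mpolyC rmorphM /= mulrCA; congr (_ * _).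
rewrite /mmap1 mpolyXE_id rmorph_prod /= mdegE -prodrXr -big_split.
by apply: eq_bigr => i _ /=; rewrite exprMn rmorphXn.
Qed.

Section ApproximateDerivation.
Variables (h : P) (Q : K -> Prop) (D : K -> K).
Hypothesis bh : basic_open h.
Hypotheses (Q0 : Q 0) (QD : forall x y, Q x -> Q y -> Q (x + y)).
Hypothesis QM : forall x y, regular h x -> Q y -> Q (x * y).
Hypothesis DD : forall x y, regular h x -> regular h y ->
  Q (D (x + y) - (D x + D y)).
Hypothesis DM : forall x y, regular h x -> regular h y ->
  Q (D (x * y) - (x * D y + y * D x)).
Hypothesis DC : forall c, Q (D (ofpoly c%:MP)).

(** D is a derivation up to errors in the submodule Q. This covers vector
    fields, and also the maps read off a trivialization of a deformation,
    which satisfy Leibniz' rule only modulo the ideal of X. *)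
Lemma chain_rule z p : (forall i, regular h (z i)) ->
  regular h (ev z p) /\
  Q (D (ev z p) - \sum_(i < n) ev z p^`M(i) * D (z i)).
Proof.
move=> hz; elim/mpoly_generated: p => [c|i|p q [Sp Qp] [Sq Qq]|p q [Sp Qp] [Sq Qq]].
- rewrite evC; split; first exact: twistC.
  by rewrite big1 ?subr0 // => i _; rewrite mderivC rmorph0 mul0r.
- rewrite evX; split=> //; rewrite (bigD1 i) //= big1 ?addr0.
    have -> : ('X_i)^`M(i) = 1 :> P.
      by rewrite mderivX mnm1E eqxx scale1r -{1}[U_(i)%MM]add0m addmK mpolyX0.
    by rewrite rmorph1 mul1r subrr.
  move=> j ji; rewrite mderivX mnm1E eq_sym (negPf ji) scale0r rmorph0 mul0r //.
- rewrite rmorphD; split; first exact: twistD.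
  have -> : \sum_(i < n) ev z (p + q)^`M(i) * D (z i) =
      \sum_(i < n) ev z p^`M(i) * D (z i) + \sum_(i < n) ev z q^`M(i) * D (z i).
    by rewrite -big_split; apply: eq_bigr => i _; rewrite mderivD rmorphD mulrDl.
  set A := \sum_(_ < _) _ in Qp *; set B := \sum_(_ < _) _ in Qq *.
  have -> : D (ev z p + ev z q) - (A + B) = (D (ev z p + ev z q) -
     (D (ev z p) + D (ev z q))) + ((D (ev z p) - A) + (D (ev z q) - B)) by ring.
  by apply: QD; [exact: DD | exact: QD].
- rewrite rmorphM; split.
    by rewrite /regular -[0]addr0; exact: twistM.
  have -> : \sum_(i < n) ev z (p * q)^`M(i) * D (z i) =
      ev z q * (\sum_(i < n) ev z p^`M(i) * D (z i)) +
      ev z p * \sum_(i < n) ev z q^`M(i) * D (z i).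
    rewrite !mulr_sumr -big_split; apply: eq_bigr => i _.
    by rewrite mderivM rmorphD !rmorphM /=; ring.
  set A := \sum_(_ < _) _ in Qp *; set B := \sum_(_ < _) _ in Qq *.
  have -> : D (ev z p * ev z q) - (ev z q * A + ev z p * B) =
     (D (ev z p * ev z q) - (ev z p * D (ev z q) + ev z q * D (ev z p))) +
     (ev z q * (D (ev z p) - A) + ev z p * (D (ev z q) - B)) by ring.
  by apply: QD; [exact: DM | apply: QD; exact: QM].
Qed.

(** This is the chain rule for f(c X_0, ..., c X_r) = c^d f. *)
Lemma chain_rule_homog (c : K) d f : (0 < d)%N -> f \is d.-homog ->
    twist h (- 1) c ->
  Q (D (c ^+ d * ofpoly f) -
     c ^+ d.-1 * \sum_(i < n) ofpoly f^`M(i) * D (c * ofpoly 'X_i)).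
Proof.
move=> d0 hf hc; rewrite -(ev_homog _ hf) mulr_sumr.
have [|_] := @chain_rule (fun i => c * ofpoly 'X_i) f.
  by move=> i; exact: (twistM bh hc (twist_var bh i)).
congr Q; congr (_ - _); apply: eq_bigr => i _.
by rewrite (ev_homog _ (mderiv_homog i hf)) mulrA.
Qed.

End ApproximateDerivation.
End ChainRule.

(** * Sections of the normal sheaf and the subschemes they define *)

Section Vanishing.
Variables (C : fieldType) (n : nat) (f : {mpoly C[n]}) (d : nat).
Local Notation P := {mpoly C[n]}.
Local Notation K := (ratfun C n).
Local Notation KE := (dual K).
Local Notation F := (ofpoly f).
Implicit Types (h g : P) (x y u v : K) (k l : int).

Lemma vanishing_normal h x :
  vanishing f d h d x <-> exists2 u, twist h 0 u & x = u * F.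
Proof. by rewrite /vanishing subrr. Qed.

Lemma vanishing_ideal h x :
  vanishing f d h 0 x <-> exists2 u, twist h (- d%:Z) u & x = u * F.
Proof. by rewrite /vanishing sub0r. Qed.

Section OnOpen.
Variable h : P.
Hypothesis bh : basic_open h.

Lemma vanishing0 k : vanishing f d h k 0.
Proof. by exists 0; rewrite ?mul0r //; exact: twist0. Qed.

Lemma vanishingD k x y :
  vanishing f d h k x -> vanishing f d h k y -> vanishing f d h k (x + y).
Proof.
by move=> [u hu ->] [v hv ->]; exists (u + v); [exact: twistD | rewrite mulrDl].
Qed.

Lemma vanishingM l k y x :
  twist h l y -> vanishing f d h k x -> vanishing f d h (l + k) (y * x).
Proof.
move=> hy [u hu ->]; exists (y * u); last by rewrite mulrA.
by rewrite -addrA; exact: twistM.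
Qed.

Lemma vanishingMr k y x :
  regular h y -> vanishing f d h k x -> vanishing f d h k (y * x).
Proof. by move=> hy hx; rewrite -[k]add0r; exact: vanishingM. Qed.

Lemma vanishingZ k (c : C) x : vanishing f d h k x -> vanishing f d h k (c *: x).
Proof. by apply: vanishingMr; exact: twistC. Qed.

Lemma vanishingN k x : vanishing f d h k x -> vanishing f d h k (- x).
Proof. by rewrite -scaleN1r; exact: vanishingZ. Qed.

Lemma vanishingB k x y :
  vanishing f d h k x -> vanishing f d h k y -> vanishing f d h k (x - y).
Proof. by move=> hx hy; apply: vanishingD => //; exact: vanishingN. Qed.

Lemma vanishing_sum k (I : Type) (r : seq I) (Q : pred I) (G : I -> K) :
  (forall i, Q i -> vanishing f d h k (G i)) ->
  vanishing f d h k (\sum_(i <- r | Q i) G i).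
Proof.
by move=> hG; elim/big_ind: _ => //; [exact: vanishing0 | exact: vanishingD].
Qed.

Lemma vanishing_restr g k x : basic_open g ->
  vanishing f d h k x -> vanishing f d (h * g) k x.
Proof. by move=> bg [u hu ->]; exists u => //; exact: twist_restr. Qed.

Hypothesis hf : f \is d.-homog.

Lemma vanishing_mul u : twist h (- d%:Z) u -> vanishing f d h 0 (u * F).
Proof. by move=> hu; apply/vanishing_ideal; exists u. Qed.

Lemma vanishing_mul0 u : twist h 0 u -> vanishing f d h d (u * F).
Proof. by move=> hu; apply/vanishing_normal; exists u. Qed.

(** By Leibniz' rule D (u f) = u D f modulo f: only the value on f matters. *)
Lemma normal_image_der (a : 'I_n -> K) t : (forall i, twist h 1 (a i)) ->
  vanishing f d h d (der a F - t) -> normal_image f d (der a) h t.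
Proof.
move=> ha ht u hu; rewrite derM.
have -> : u * der a F + F * der a u - u * t = u * (der a F - t) + der a u * F by ring.
apply: vanishingD; last by apply/vanishing_mul/der_twist.
by rewrite -(addNr d%:Z); exact: vanishingM.
Qed.

End OnOpen.

Section Inclusion.
Variables h h' : P.
Hypotheses (bh : basic_open h) (bh' : basic_open h').
Hypothesis incl : forall k x, twist h k x -> twist h' k x.

Lemma vanishing_incl k x : vanishing f d h k x -> vanishing f d h' k x.
Proof. by move=> [u hu ->]; exists u => //; exact: incl. Qed.

(** O(-d) is invertible, with generators that come from the larger open set: a
    section x of O(d) vanishes on X as soon as its products with these do. *)
Lemma vanishing_locally x : [pchar C] =i pred0 ->
  (forall u, twist h (- d%:Z) u -> vanishing f d h' 0 (u * x)) ->
  vanishing f d h' d x.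
Proof.
move=> char0 hx; have [t [ht t1]] := unity_pairs_exist d char0 bh.
rewrite -[x]mul1r -t1 mulr_suml big_seq; apply: vanishing_sum => // z /ht[z1 z2].
rewrite mulrAC mulrC -[X in vanishing f d h' X _]addr0.
by apply: (vanishingM bh' (incl z2)); exact: hx.
Qed.

End Inclusion.

Lemma vanishing_restrl h g k x : basic_open h -> basic_open g ->
  vanishing f d g k x -> vanishing f d (h * g) k x.
Proof. by move=> bh bg; rewrite mulrC; exact: vanishing_restr. Qed.

Lemma normal_section_restr (s : P -> K) h g : normal_section f d s ->
  basic_open h -> basic_open g -> vanishing f d (h * g) d (s (h * g) - s h).
Proof. by case=> _; apply. Qed.

Lemma deformation_ofP (s : P -> K) h (x y : K) :
  deformation_of f d s h (x, y) <-> exists u v : K,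
   [/\ twist h (- d%:Z) u, twist h (- d%:Z) v, x = u * F & y = u * s h + v * F].
Proof.
split=> [[u [v [hu hv [-> ->]]]]|[u [v [hu hv -> ->]]]]; exists u, v; split=> //.
Qed.

Lemma sum_dual (I : Type) (r : seq I) (G : I -> KE) :
  \sum_(i <- r) G i = (\sum_(i <- r) (G i).1, \sum_(i <- r) (G i).2).
Proof.
elim: r => [|i r IH]; first by rewrite !big_nil.
by rewrite !big_cons IH.
Qed.

Lemma deformation_ideal (s : P -> K) h : normal_section f d s -> f \is d.-homog ->
  basic_open h -> is_ideal (regular_eps h) (deformation_of f d s h).
Proof.
move=> [hs _] hf bh; split.
- by apply/deformation_ofP; exists 0, 0; rewrite !mul0r addr0; split=> //; exact: twist0.
- move=> [x y] /deformation_ofP[u [v [hu hv -> ->]]].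
  have tF : twist h d F by apply/twist_poly/zhomog_dhomog.
  have hM w z : twist h (- d%:Z) w -> twist h d%:Z z -> twist h 0 (w * z).
    by move=> hw hz; rewrite -(addNr d%:Z); exact: twistM.
  split; first exact: hM.
  rewrite /regular /=; apply: twistD => //; last exact: hM.
  by apply: hM => //; exact: hs.
- move=> [a1 a2] [x y] [x' y'] [/= ha1 ha2].
  move=> /deformation_ofP[u [v [hu hv -> ->]]] /deformation_ofP[u' [v' [hu' hv' -> ->]]].
  apply/deformation_ofP; exists (a1 * u + u'), (a1 * v + a2 * u + v').
  have hM w z : twist h 0 w -> twist h (- d%:Z) z -> twist h (- d%:Z) (w * z).
    by move=> hw hz; rewrite -[X in twist h X _]add0r; exact: twistM.
  split; [| |rewrite /=; ring|rewrite /=; ring].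
    by apply: twistD => //; exact: hM.
  by apply: twistD => //; apply: twistD => //; exact: hM.
Qed.

Lemma deformation_restr (s : P -> K) h g (x : KE) : normal_section f d s ->
  basic_open h -> basic_open g ->
  deformation_of f d s h x -> deformation_of f d s (h * g) x.
Proof.
move=> hs bh bg; case: x => [x y] /deformation_ofP[u [v [hu hv -> ->]]].
have bhg := basic_openM bh bg.
have /vanishing_normal[w hw sE] := normal_section_restr hs bh bg.
apply/deformation_ofP; exists u, (v - u * w); split=> //.
- exact: twist_restr.
- apply: twistB => //; first exact: twist_restr.
  by rewrite -[X in twist _ X _]addr0; apply: twistM => //; exact: twist_restr.
- by rewrite mulrBl -mulrA -sE; ring.
Qed.

(** Sections u of O(-d) over D+(hg) come from D+(h) up to functions over
    D+(hg): u is the sum of the (u z.2) z.1 for a family z with the sum of z.1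
    z.2 equal to 1. *)
Lemma deformation_closed_subscheme (s : P -> K) : [pchar C] =i pred0 ->
  normal_section f d s -> f \is d.-homog ->
  closed_subscheme (deformation_of f d s).
Proof.
move=> char0 hs hf; split=> [h|h g [x y] bh bg]; first exact: deformation_ideal.
have bhg := basic_openM bh bg.
split=> [/deformation_ofP[u [v [hu hv -> ->]]]|[t ht ->]]; last first.
  have [I0 _ Ilin] := deformation_ideal hs hf bhg.
  elim: t ht => [|z t IH] ht; first by rewrite big_nil.
  rewrite big_cons; have [hz1 hz2] := ht z (mem_head _ _).
  apply: Ilin => //; first exact: deformation_restr.
  by apply: IH => w wt; apply: ht; rewrite inE wt orbT.
have [t [ht t1]] := unity_pairs_exist d char0 bh.
have /vanishing_normal[w hw sE] := normal_section_restr hs bh bg.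
pose c := v + u * w.
have hc : twist (h * g) (- d%:Z) c.
  apply: twistD => //; rewrite -[X in twist _ X _]addr0; exact: twistM.
exists [seq ((u * z.2, c * z.2) : KE, (z.1 * F, z.1 * s h) : KE) | z <- t].
  move=> _ /mapP[z /ht[z1 z2] ->] /=; split.
    by split; rewrite /= /regular -(addNr d%:Z); apply: twistM => //; exact: twist_restr.
  by apply/deformation_ofP; exists z.1, 0; rewrite mul0r addr0; split=> //; exact: twist0.
rewrite big_map sum_dual /=; congr pair.
  transitivity (u * F * (\sum_(z <- t) z.1 * z.2)); first by rewrite t1 mulr1.
  by rewrite mulr_sumr; apply: eq_bigr => z _; ring.
transitivity ((u * s h + c * F) * (\sum_(z <- t) z.1 * z.2)).
  rewrite t1 mulr1 /c mulrDl -mulrA -sE; ring.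
by rewrite mulr_sumr; apply: eq_bigr => z _; ring.
Qed.

Lemma same_deformation (s t : P -> K) : [pchar C] =i pred0 -> f != 0 ->
  f \is d.-homog -> normal_section f d s -> normal_section f d t ->
  same_subscheme (deformation_of f d s) (deformation_of f d t) <->
  zero_section f d (s - t).
Proof.
move=> char0 f0 hf hs ht; split=> [same h bh|st0 h [x y] bh].
  apply: (vanishing_locally bh bh) => // u hu.
  have /(same h _ bh)/deformation_ofP[u' [v [hu' hv uE E]]] :
      deformation_of f d s h (u * F, u * s h).
    by apply/deformation_ofP; exists u, 0; rewrite mul0r addr0; split=> //; exact: twist0.
  have {}uE := mulIf (ofpoly_neq0 f0) uE; subst u'.
  rewrite (_ : u * (s - t) h = v * F); first exact: vanishing_mul.
  have -> : (s - t) h = s h - t h by [].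
  by rewrite mulrBr E addrAC subrr add0r.
have [w hw stE] : exists2 w, twist h 0 w & s h - t h = w * F.
  by apply/vanishing_normal; exact: st0.
have hM u v e : twist h (- d%:Z) u -> twist h (- d%:Z) v -> twist h 0 e ->
    twist h (- d%:Z) (v + u * e).
  move=> hu hv he; apply: twistD => //.
  by rewrite -[X in twist _ X _]addr0; exact: twistM.
split=> /deformation_ofP[u [v [hu hv -> ->]]]; apply/deformation_ofP.
  exists u, (v + u * w); split=> //; first exact: hM.
  by rewrite mulrDl -mulrA -stE; ring.
exists u, (v + u * (- w)); split=> //.
  by apply: hM => //; exact: twistN.
by rewrite mulrDl -mulrA mulNr -stE; ring.
Qed.

End Vanishing.

(** * Modules over the dual numbers *)

Section DualModules.
Variable C : fieldType.
Local Notation A := (dual C).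

Definition scal (c : C) : A := (c, 0).
Definition eps : A := (0, 1).

Lemma scalD (a b : C) : scal (a + b) = scal a + scal b.
Proof. by congr pair; rewrite addr0. Qed.

Lemma scalM (a b : C) : scal (a * b) = scal a * scal b.
Proof. by congr pair => /=; rewrite mulr0 mul0r addr0. Qed.

Lemma dualE (a : A) : a = scal a.1 + scal a.2 * eps.
Proof.
by case: a => a b; congr pair => /=; rewrite ?mulr0 ?mulr1 ?mul0r ?addr0 ?add0r.
Qed.

Lemma eps_mul (a : A) : eps * a = scal a.1 * eps.
Proof. by congr pair => /=; ring. Qed.

Definition restricted (N : lmodType A) : Type := N.

Section Restricted.
Variable N : lmodType A.
HB.instance Definition _ := GRing.Zmodule.on (restricted N).
Definition restricted_scale (c : C) (u : restricted N) : restricted N :=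
  scal c *: (u : N).
Fact restricted_scaleA a b u :
  restricted_scale a (restricted_scale b u) = restricted_scale (a * b) u.
Proof. by rewrite /restricted_scale scalerA -scalM. Qed.
Fact restricted_scale1 : left_id 1 restricted_scale.
Proof. by move=> u; rewrite /restricted_scale scale1r. Qed.
Fact restricted_scaleDr : right_distributive restricted_scale +%R.
Proof. by move=> a u v; rewrite /restricted_scale scalerDr. Qed.
Fact restricted_scaleDl u : {morph restricted_scale^~ u : a b / a + b}.
Proof. by move=> a b; rewrite /restricted_scale scalD scalerDl. Qed.
HB.instance Definition _ := GRing.Zmodule_isLmodule.Build C (restricted N)
  restricted_scaleA restricted_scale1 restricted_scaleDr restricted_scaleDl.
End Restricted.

Section Extended.
Variable V : lmodType C.

(** This is the module of C-linear maps from C[eps] to V: a C-linear map l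
    from a C[eps]-module to V yields the C[eps]-linear map u |-> (l (eps u), l
    u) to it. *)
Definition coinduced : Type := (V * V)%type.
HB.instance Definition _ := GRing.Zmodule.copy coinduced (V * V)%type.
Definition coinduced_scale (a : A) (w : coinduced) : coinduced :=
  (a.1 *: w.1, a.1 *: w.2 + a.2 *: w.1).
Fact coinduced_scaleA a b w :
  coinduced_scale a (coinduced_scale b w) = coinduced_scale (a * b) w.
Proof.
congr pair => /=; first by rewrite scalerA.
by rewrite scalerDr scalerDl !scalerA addrA.
Qed.
Fact coinduced_scale1 : left_id 1 coinduced_scale.
Proof. by case=> u v; congr pair => /=; rewrite !scale1r // scale0r addr0. Qed.
Fact coinduced_scaleDr : right_distributive coinduced_scale +%R.
Proof.
move=> a [u v] [u' v']; congr pair => /=; first by rewrite scalerDr.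
by rewrite !scalerDr addrACA.
Qed.
Fact coinduced_scaleDl w : {morph coinduced_scale^~ w : a b / a + b}.
Proof.
move=> [a a'] [b b']; congr pair => /=; first by rewrite scalerDl.
by rewrite !scalerDl addrACA.
Qed.
HB.instance Definition _ := GRing.Zmodule_isLmodule.Build A coinduced
  coinduced_scaleA coinduced_scale1 coinduced_scaleDr coinduced_scaleDl.

Definition residual : Type := V.
HB.instance Definition _ := GRing.Zmodule.on residual.
Definition residual_scale (a : A) (v : residual) : residual := a.1 *: (v : V).
Fact residual_scaleA a b v :
  residual_scale a (residual_scale b v) = residual_scale (a * b) v.
Proof. by rewrite /residual_scale scalerA. Qed.
Fact residual_scale1 : left_id 1 residual_scale.
Proof. by move=> v; rewrite /residual_scale scale1r. Qed.
Fact residual_scaleDr : right_distributive residual_scale +%R.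
Proof. by move=> a u v; rewrite /residual_scale scalerDr. Qed.
Fact residual_scaleDl v : {morph residual_scale^~ v : a b / a + b}.
Proof. by move=> a b; rewrite /residual_scale scalerDl. Qed.
HB.instance Definition _ := GRing.Zmodule_isLmodule.Build A residual
  residual_scaleA residual_scale1 residual_scaleDr residual_scaleDl.
End Extended.

Lemma linear_retraction (N N' : lmodType A) (phi : {linear N -> N'}) :
  injective phi -> exists rho : N' -> N,
    (forall c u v, rho (scal c *: u + v) = scal c *: rho u + rho v) /\
    (forall u, rho (phi u) = u).
Proof.
move=> phiI.
(* The inverse of phi on its image extends to N', over the constants. *)
pose U (u' : restricted N') := exists u, phi u = u'.
pose g (u' : restricted N') : restricted N :=
  if pselect (U u') is left e then projT1 (cid e) else 0.
have gphi u : g (phi u) = u.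
  rewrite /g; case: pselect => [e|]; last by case; exists u.
  by case: cid => v /= /phiI.
have [| |c _ _ [u <-] [v <-]||rho [rlin rE _]] := @linear_extension _ _ _ U (fun=> True) g.
- split; first by exists 0; rewrite linear0.
  by move=> c _ _ [u <-] [v <-]; exists (scal c *: u + v); rewrite linearP.
- by [].
- by rewrite -[c *: _ + _]/(scal c *: phi u + phi v) -linearP !gphi.
- by [].
exists rho; split=> // u.
by rewrite rE ?gphi //; exists u.
Qed.

End DualModules.

(** * Flatness of the subscheme defined by a normal section *)

Section Deformations.
Variables (C : fieldType) (n : nat) (f : {mpoly C[n]}) (d : nat).
Local Notation P := {mpoly C[n]}.
Local Notation K := (ratfun C n).
Local Notation A := (dual C).
Local Notation KE := (dual K).
Local Notation F := (ofpoly f).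
Implicit Types (h g : P).

Lemma regular_subspace h : basic_open h -> subspace (regular h : K -> Prop).
Proof.
move=> bh; split; first exact: twist0.
by move=> a u v hu hv; apply: twistD => //; exact: twistZ.
Qed.

Lemma vanishing_subspace h k : basic_open h -> subspace (vanishing f d h k).
Proof.
move=> bh; split; first exact: vanishing0.
by move=> a u v hu hv; apply: vanishingD => //; exact: vanishingZ.
Qed.

Lemma constant_scal (c : C) (x y : K) :
  constant_eps n (scal c) * ((x, y) : KE) = (c *: x, c *: y) :> KE.
Proof. by congr pair; rewrite /= ?rmorph0 mul0r addr0. Qed.

Lemma constant_mulE (a : A) (x y : K) :
  constant_eps n a * ((x, y) : KE) = (a.1 *: x, a.1 *: y + a.2 *: x) :> KE.
Proof. by []. Qed.

Section Bilinear.
Variables (h : P) (I : KE -> Prop) (N Z : lmodType A) (b : N -> KE -> Z).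
Hypothesis bh : basic_open h.
Hypothesis bb : bilinear_map (regular_eps h) I b.

Lemma bilinear_left a u v x : regular_eps h x ->
  b (a *: u + v) x = a *: b u x + b v x.
Proof. by case: bb => + _ _; apply. Qed.

Lemma bilinear_right a u x y : regular_eps h x -> regular_eps h y ->
  b u (constant_eps n a * x + y) = a *: b u x + b u y.
Proof. by case: bb => _ + _; apply. Qed.

Lemma bilinear_kills u x : I x -> b u x = 0.
Proof. by case: bb => _ _; apply. Qed.

Lemma bilinear_rightD u x y : regular_eps h x -> regular_eps h y ->
  b u (x + y) = b u x + b u y.
Proof.
move=> hx hy; have := bilinear_right 1 u hx hy; rewrite scale1r => <-.
by rewrite (_ : constant_eps n 1 = 1) ?mul1r.
Qed.

Lemma bilinear_left0 x : regular_eps h x -> b 0 x = 0.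
Proof.
move=> hx; have /eqP := bilinear_left 1 0 0 hx; rewrite !scale1r addr0.
by rewrite -subr_eq0 opprD addNKr oppr_eq0 => /eqP.
Qed.

Lemma bilinear_leftZ a u x : regular_eps h x -> b (a *: u) x = a *: b u x.
Proof. by move=> hx; rewrite -[a *: u]addr0 bilinear_left // bilinear_left0 // addr0. Qed.

Lemma bilinear_rightZ a u x : I 0 -> regular_eps h x ->
  b u (constant_eps n a * x) = a *: b u x.
Proof.
move=> I0 hx; rewrite -[_ * x]addr0 bilinear_right //.
  by rewrite (bilinear_kills _ I0) addr0.
by split; exact: twist0.
Qed.

End Bilinear.

Section Flat.
Variables (s : P -> K) (h : P).
Hypotheses (f0 : f != 0) (hf : f \is d.-homog) (hs : normal_section f d s).
Hypothesis bh : basic_open h.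
Local Notation I := (deformation_of f d s h).
Local Notation S := (regular_eps h).

(** Such an l provides a C-linear lift x |-> x + eps l(x) of functions which
    maps the ideal of X into the ideal of the deformation. *)
Lemma deformation_splitting : exists l : K -> K,
  [/\ forall a u v, l (a *: u + v) = a *: l u + l v,
      forall u, twist h (- d%:Z) u -> l (u * F) = u * s h
    & forall v, regular h (l v)].
Proof.
have F0 := ofpoly_neq0 f0.
have [||a u v _ _|u /vanishing_ideal[w hw ->]|l [llin lE lreg]] :=
  @linear_extension C K K (vanishing f d h 0) (regular h) (fun x => x / F * s h).
- exact: vanishing_subspace.
- exact: regular_subspace.
- by rewrite !ratfun_scaleE; ring.
- rewrite (mulfK F0) /regular -(addNr d%:Z); apply: twistM => //.
  by case: hs => + _; apply.
- exists l; split=> // u hu.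
  by rewrite lE ?mulfK //; exact: vanishing_mul.
Qed.

(** Write S for the functions on D+(h). The lift L(x) = x + eps l(x)
    identifies S[eps]/I with the extension of scalars of S/I_X, which is free.
    Concretely, every element of S[eps] is L(x_0) + eps L(y); with a C-linear
    retraction rho of phi, a bilinear map b on N is prolonged to a bilinear
    map on N' with values in a coinduced module, whose second component at
    phi(u) is b u. *)
Lemma deformation_flat : flat_quotient S I.
Proof.
move=> N N' phi phiI t tS zero Z b bb.
have [I0 IS Ilin] := deformation_ideal hs hf bh.
have [l [llin lF lreg]] := deformation_splitting.
have [rho [rholin rhophi]] := linear_retraction phiI.
pose L (x : K) : KE := (x, l x).
have LS x : regular h x -> S (L x) by move=> hx; split=> //; exact: lreg.
have LP c (x y : K) : L (c *: x + y) = constant_eps n (scal c) * L x + L y.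
  by rewrite constant_scal; congr pair; rewrite llin.
have LI u : twist h (- d%:Z) u -> I (L (u * F)).
  move=> hu; apply/deformation_ofP; exists u, 0; split=> //; first exact: twist0.
  by rewrite mul0r addr0 lF.
pose Y (x : KE) : K := x.2 - l x.1.
have YS x : S x -> regular h (Y x) by case=> h1 h2; apply: twistB => //; exact: lreg.
pose b' (u' : N') (x : KE) : coinduced (restricted Z) :=
  (b (rho (eps C *: u')) (L x.1),
   b (rho u') (L x.1) + b (rho (eps C *: u')) (L (Y x))).
have bb' : bilinear_map S I b'.
  split.
  - move=> a u v x Sx; have [Sx1 _] := Sx.
    have rho_eps : rho (eps C *: (a *: u + v)) =
        scal a.1 *: rho (eps C *: u) + rho (eps C *: v).
      by rewrite scalerDr scalerA eps_mul -scalerA rholin.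
    (* a = a.1 + a.2 eps, and rho is linear over the constants only. *)
    have rho_lin : rho (a *: u + v) =
        scal a.1 *: rho u + (scal a.2 *: rho (eps C *: u) + rho v).
      by rewrite {1}(dualE a) scalerDl -addrA rholin -scalerA rholin.
    rewrite /b' rho_eps rho_lin; congr pair => /=.
      by rewrite (bilinear_left bb) //; exact: LS.
    rewrite !(bilinear_left bb) //; try exact: LS; last exact/LS/YS.
    rewrite -![_ *: (_ : restricted Z)]/(scal _ *: (_ : Z)).
    rewrite scalerDr -!addrA; congr (_ + _).
    by rewrite [RHS]addrCA; congr (_ + _); rewrite addrCA.
  - move=> a u x y Sx Sy; have [Sx1 Sx2] := Sx; have [Sy1 Sy2] := Sy.
    have L1 : L (constant_eps n a * x + y).1 =
        constant_eps n (scal a.1) * L x.1 + L y.1 by rewrite -LP.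
    have L2 : L (Y (constant_eps n a * x + y)) = constant_eps n (scal a.1) * L (Y x) +
       (constant_eps n (scal a.2) * L x.1 + L (Y y)).
      rewrite -!LP; congr L; rewrite /Y /=.
      by rewrite -[ofpoly a.1%:MP * x.1]/(a.1 *: x.1) llin !ratfun_scaleE; ring.
    have SaL : S (constant_eps n (scal a.2) * L x.1 + L (Y y)).
      by rewrite -LP; apply: LS; apply: (twistD bh); [exact: twistZ | exact: YS].
    rewrite /b' L1 L2; congr pair => /=.
      by rewrite (bilinear_right bb) //; exact: LS.
    rewrite !(bilinear_right bb) //; try exact: LS; try exact/LS/YS.
    rewrite -![_ *: (_ : restricted Z)]/(scal _ *: (_ : Z)).
    rewrite scalerDr -!addrA; congr (_ + _).
    by rewrite [LHS]addrCA; congr (_ + _); rewrite [LHS]addrCA.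
  - move=> u [x y] /deformation_ofP[w [v [hw hv -> ->]]].
    have YE : Y (w * F, w * s h + v * F) = v * F by rewrite /Y /= lF // addrAC subrr add0r.
    rewrite /b' YE /= !(bilinear_kills bb) ?addr0 //; exact: LI.
have := zero _ _ bb'; rewrite big_map => /(congr1 snd) /=.
have sum_snd (r : seq (N * KE)) (G : N * KE -> coinduced (restricted Z)) :
    (\sum_(i <- r) G i).2 = \sum_(i <- r) ((G i).2 : Z) :> Z.
  by elim: r => [|i r IH]; rewrite ?big_nil // !big_cons -IH.
rewrite sum_snd => E; rewrite -[RHS]E [LHS]big_seq [RHS]big_seq.
apply: eq_bigr => -[u [x y]] /tS[/= hx hy].
rewrite -linearZ !rhophi.
have SLY : S (L (y - l x)) by apply: LS; apply: twistB => //; exact: lreg.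
have epsL : constant_eps n (eps C) * L (y - l x) = (0, y - l x) :> KE.
  by rewrite constant_mulE /= !scale0r add0r scale1r.
rewrite (bilinear_leftZ bb) // -(bilinear_rightZ bh bb) // epsL.
rewrite -(bilinear_rightD bb); first last.
- by split; [exact: twist0 | apply: twistB => //; exact: lreg].
- exact: LS.
by congr b; congr pair; rewrite /= ?addr0 // addrC subrK.
Qed.

End Flat.
End Deformations.

(** * Vector fields and local triviality *)

Section LocalTriviality.
Variables (C : fieldType) (n : nat) (f : {mpoly C[n]}) (d : nat).
Local Notation P := {mpoly C[n]}.
Local Notation K := (ratfun C n).
Local Notation A := (dual C).
Local Notation KE := (dual K).
Local Notation F := (ofpoly f).
Implicit Types (h g : P).

Section VectorField.
Variables (h : P) (D : K -> K).
Hypotheses (bh : basic_open h) (vD : vector_field h D).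

Lemma vector_field_regular x : regular h x -> regular h (D x).
Proof. by case: vD => + _ _; apply. Qed.

Lemma vector_fieldM x y : regular h x -> regular h y ->
  D (x * y) = x * D y + y * D x.
Proof. by case: vD => _ _; apply. Qed.

Lemma vector_fieldD x y : regular h x -> regular h y -> D (x + y) = D x + D y.
Proof.
move=> hx hy; have [_ lin _] := vD.
by have := lin 1 x y hx hy; rewrite !scale1r.
Qed.

Lemma vector_field0 : D 0 = 0.
Proof.
have h0 : regular h (0 : K) := twist0 bh 0.
have /eqP := vector_fieldD h0 h0; rewrite addr0 -subr_eq0 opprD addNKr.
by rewrite oppr_eq0 => /eqP.
Qed.

Lemma vector_field1 : D 1 = 0.
Proof.
have h1 : regular h (1 : K) := twist1 bh.
have /eqP := vector_fieldM h1 h1; rewrite mulr1 mul1r -subr_eq0 opprD addNKr.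
by rewrite oppr_eq0 => /eqP.
Qed.

Lemma vector_fieldC (c : C) : D (ofpoly c%:MP) = 0.
Proof.
have h1 : regular h (1 : K) := twist1 bh.
have h0 : regular h (0 : K) := twist0 bh 0.
have [_ lin _] := vD; have := lin c 1 0 h1 h0.
by rewrite vector_field1 vector_field0 !addr0 scaler0 ratfun_scaleE mulr1.
Qed.

End VectorField.

(** The automorphism 1 - eps D of the functions over C[eps] sends (u, v) (f,
    s) to u f + eps (u s - D (u f) + v f), hence the ideal of the deformation
    onto that of the trivial one. *)
Lemma trivial_over_deformation (s : P -> K) h D : f \is d.-homog ->
  normal_section f d s -> basic_open h -> vector_field h D ->
  normal_image f d D h (s h) -> trivial_over f d h (deformation_of f d s).
Proof.
move=> hf [hs _] bh vD im; have v0 := vanishing0 f d bh 0.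
have D0 : D 0 = 0 := vector_field0 bh vD.
exists (fun x : KE => (x.1, x.2 - D x.1)); split.
- move=> [x y] [/= hx hy]; split=> //=.
  by apply: twistB => //; exact: (vector_field_regular vD).
- split=> [[x y] [x' y'] [/= hx hy] [/= hx' hy']|[x y] [x' y'] [/= hx hy] [/= hx' hy']|a].
  + split=> /=; first by rewrite subrr.
    rewrite (vector_fieldD vD) // (_ : _ - _ = 0) //; ring.
  + split=> /=; first by rewrite subrr.
    rewrite (vector_fieldM vD) // (_ : _ - _ = 0) //; ring.
  + by split; rewrite /= ?(vector_fieldC bh vD) ?subr0 subrr.
- move=> [x y] [/= hx hy]; split.
    move=> /deformation_ofP[u [v [hu hv -> ->]]]; split=> /=.
      exact: vanishing_mul.
    rewrite addrAC -opprB addrC; apply: vanishingB => //; first exact: vanishing_mul.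
    exact: im.
  move=> [/= /vanishing_ideal[u hu xE] /vanishing_ideal[v hv yE]].
  have /vanishing_ideal[w hw wE] := im u hu.
  apply/deformation_ofP; exists u, (v + w); split=> //; first exact: twistD.
  by rewrite mulrDl -yE -wE xE; ring.
- move=> [x y] [/= hx hy]; exists (x, y + D x).
    by split=> //=; apply: twistD => //; exact: (vector_field_regular vD).
  by split; rewrite /= ?addrK subrr.
- by move=> [x y] _; rewrite /= subrr.
Qed.

Theorem deformation_of_locally_trivial (s : P -> K) : [pchar C] =i pred0 ->
  f != 0 -> f \is d.-homog -> H0_N' f d s ->
  locally_trivial_deformation f d (deformation_of f d s).
Proof.
move=> char0 f0 hf [hs loc]; split; last first.
  move=> p pp pf; have [h [D [bh ph vD im]]] := loc p pp pf.
  by exists h => //; exact: (trivial_over_deformation hf hs bh vD).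
split=> [|h bh|h x bh]; first exact: deformation_closed_subscheme.
  exact: deformation_flat.
split=> [/vanishing_ideal[u hu ->]|[y /deformation_ofP[u [v [hu _ -> _]]]]].
  exists (u * s h); apply/deformation_ofP; exists u, 0.
  by split=> //; [exact: twist0 | rewrite mul0r addr0].
exact: vanishing_mul.
Qed.

(** A derivation D up to the ideal of X, defined on functions only, is
    replaced by the derivation with coefficients D (c X_j) / c on the X_j,
    which is exact and acts on forms. The two agree on f modulo f by the chain
    rule, and this is all that matters for the map to the normal sheaf. *)
Lemma local_form h h' (c : K) (D : K -> K) (t : K) :
    (0 < d)%N -> f \is d.-homog -> basic_open h -> basic_open h' ->
    (forall k x, twist h k x -> twist h' k x) ->
    c != 0 -> twist h (- 1) c -> twist h' 1 c^-1 ->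
    (forall x y, regular h x -> regular h y ->
       vanishing f d h 0 (D (x + y) - (D x + D y))) ->
    (forall x y, regular h x -> regular h y ->
       vanishing f d h 0 (D (x * y) - (x * D y + y * D x))) ->
    (forall a : C, vanishing f d h 0 (D (ofpoly a%:MP))) ->
    vanishing f d h 0 (D (c ^+ d * F) - c ^+ d * t) ->
  vanishing f d h' d (der (fun j => c^-1 * D (c * ofpoly 'X_j)) F - t).
Proof.
move=> d0 hf bh bh' incl c0 hc hc' DD DM DC Dt.
have := chain_rule_homog bh (vanishing0 f d bh 0)
  (@vanishingD _ _ f d h bh 0) (@vanishingMr _ _ f d h bh 0) DD DM DC d0 hf hc.
move=> /(vanishingB bh Dt).
set G := \sum_(_ < _) _; set y := (X in vanishing _ _ _ _ X) => hy.
have -> : der (fun j => c^-1 * D (c * ofpoly 'X_j)) F - t = (c^-1) ^+ d * y.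
  have -> : der (fun j => c^-1 * D (c * ofpoly 'X_j)) F = c^-1 * G.
    by rewrite der_poly mulr_sumr; apply: eq_bigr => j _; ring.
  have -> : y = c ^+ d.-1 * G - c ^+ d * t by rewrite /y; ring.
  have cd : (c^-1) ^+ d * c ^+ d = 1 by rewrite -exprMn (mulVf c0) expr1n.
  have cd1 : (c^-1) ^+ d * c ^+ d.-1 = c^-1.
    rewrite -[in X in X * _](prednK d0) exprS -mulrA -exprMn (mulVf c0).
    by rewrite expr1n mulr1.
  by rewrite mulrBr !mulrA cd cd1 mul1r.
rewrite -[X in vanishing _ _ _ X _]addr0; apply: vanishingM => //.
  by rewrite -[d%:Z]mulr1; exact: twistXn.
exact: (vanishing_incl incl).
Qed.

End LocalTriviality.

(** * From deformations to normal sections *)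

Section FromDeformations.
Variables (C : fieldType) (n : nat) (f : {mpoly C[n]}) (d : nat).
Local Notation P := {mpoly C[n]}.
Local Notation K := (ratfun C n).
Local Notation A := (dual C).
Local Notation KE := (dual K).
Local Notation F := (ofpoly f).
Implicit Types (h g : P).
Hypotheses (char0 : [pchar C] =i pred0) (hf : f \is d.-homog) (f0 : f != 0).

Definition times_eps (c : residual C^o) : (A^o : lmodType A) := (0, c).
Fact times_eps_linear : linear times_eps.
Proof.
move=> a u v; congr pair => /=; first by rewrite mulr0 addr0.
by rewrite mulr0 addr0.
Qed.
HB.instance Definition _ := GRing.isLinear.Build A (residual C^o) A^o _ times_eps
  times_eps_linear.

(** Flatness is tested on the inclusion of C = eps C[eps] in C[eps]. If (0, y)
    is in I then eps (x) y = 0, so that the class of y in S/I_X is 0. A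
    C-linear projection l onto the functions that vanish on X makes x |-> x -
    l x a bilinear map that detects this class. *)
Lemma flat_closed_fibre h (I : KE -> Prop) (y : K) : basic_open h ->
    is_ideal (regular_eps h) I -> flat_quotient (regular_eps h) I ->
    (forall x, vanishing f d h 0 x <-> exists y, I (x, y)) ->
  I (0, y) -> vanishing f d h 0 y.
Proof.
move=> bh [I0 IS Ilin] flat fibre Iy; have [_ /= hy] := IS _ Iy.
have sy : regular_eps h ((y, 0) : KE) by split=> //; exact: twist0.
have [||a u v _ _|u //|l [llin lE lv]] := @linear_extension C K K
  (vanishing f d h 0) (vanishing f d h 0) id.
- exact: vanishing_subspace.
- exact: vanishing_subspace.
- by [].
pose b (c : residual C^o) (x : KE) : residual K :=
  (c : C) *: (x.1 - l x.1 : K).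
have bb : bilinear_map (regular_eps h) I b.
  split=> [a u v x _|a u x z _ _|u [x z] Ixz].
  - transitivity ((a.1 * (u : C) + (v : C)) *: (x.1 - l x.1)); first by [].
    by rewrite scalerDl -scalerA.
  - transitivity ((u : C) *: (a.1 *: x.1 + z.1 - l (a.1 *: x.1 + z.1))); first by [].
    transitivity (a.1 *: ((u : C) *: (x.1 - l x.1)) + (u : C) *: (z.1 - l z.1)) => //.
    rewrite llin scalerA mulrC -scalerA -scalerDr.
    by rewrite [a.1 *: (_ - _)]scalerBr opprD addrACA.
  - by rewrite /b /= lE ?subrr ?scaler0 //; apply/fibre; exists z.
have inj : injective times_eps by move=> u v [].
have zero : tensor_zero (regular_eps h) I [:: ((1 : C) : residual C^o, (y, 0) : KE)].
  apply: (flat _ _ times_eps inj) => [z|]; first by rewrite inE => /eqP->.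
  move=> Z b' bb'; rewrite /= big_seq1 /=.
  have -> : times_eps 1 = eps C *: (1 : A^o) by rewrite /times_eps; congr pair => /=; ring.
  rewrite (bilinear_leftZ bb') // -(bilinear_rightZ bh bb') //.
  rewrite (bilinear_kills bb') // constant_mulE /=.
  by rewrite !scale0r scale1r add0r.
have := zero _ b bb; rewrite big_seq1 /b /= scale1r => /eqP.
by rewrite subr_eq0 => /eqP ->.
Qed.

Section EquationSection.
Variable I : P -> KE -> Prop.
Hypothesis defI : first_order_deformation f d I.

Let closedI : closed_subscheme I. Proof. by case: defI. Qed.

Lemma deformation_is_ideal h : basic_open h -> is_ideal (regular_eps h) (I h).
Proof. by case: closedI => + _; apply. Qed.

Lemma deformation_fibre h x : basic_open h ->
  vanishing f d h 0 x <-> exists y, I h (x, y).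
Proof. by case: defI => _ _ + bh; apply. Qed.

Lemma deformation_kernel h y : basic_open h -> I h (0, y) -> vanishing f d h 0 y.
Proof.
move=> bh; apply: (flat_closed_fibre bh (deformation_is_ideal bh)).
  by case: defI => _ + _; apply.
by move=> x; exact: deformation_fibre.
Qed.

Lemma ideal_eps h x y : basic_open h -> I h (x, y) -> I h (0, x).
Proof.
move=> bh Ixy; have [I0 _ Ilin] := deformation_is_ideal bh.
have Seps : regular_eps h ((0, 1) : KE).
  by split; [exact: twist0 | exact: twist1].
have := Ilin _ _ _ Seps Ixy I0; congr I; congr pair => /=; ring.
Qed.

(** By flatness I is the graph of a linear map from the ideal of X to
    functions on X, which maps u f to psi u. As O(-d) is invertible, it is the
    multiplication by the sum of the v psi(u), where 1 is the sum of the u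
    v. *)
Lemma local_equation h : basic_open h -> exists s : K, twist h d s /\
  forall u v, twist h (- d%:Z) u -> twist h (- d%:Z) v ->
    I h (u * F, u * s + v * F).
Proof.
move=> bh; have [t [ht t1]] := unity_pairs_exist d char0 bh.
have [I0 IS Ilin] := deformation_is_ideal bh.
have lift u : exists y, twist h (- d%:Z) u -> I h (u * F, y).
  have [hu|nu] := pselect (twist h (- d%:Z) u); last by exists 0.
  have /(deformation_fibre _ bh)[y Iy] := vanishing_mul f hu.
  by exists y.
pose psi u := projT1 (cid (lift u)).
have Ipsi u : twist h (- d%:Z) u -> I h (u * F, psi u) by rewrite /psi; case: cid.
exists (\sum_(z <- t) z.2 * psi z.1); split.
  rewrite big_seq; apply: twist_sum => // z /ht[z1 z2].
  rewrite -[d%:Z]addr0; apply: twistM => //.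
  by have [_] := IS _ (Ipsi _ z1).
move=> u v hu hv.
(* Since u is the sum of the (u z.2) z.1, this element is the sum of the (u
   z.2) (z.1 f + eps psi z.1). *)
have Iu : I h (u * F, u * \sum_(z <- t) z.2 * psi z.1).
  have -> : ((u * F, u * \sum_(z <- t) z.2 * psi z.1) : KE) =
     \sum_(z <- t) ((u * z.2, 0) : KE) * ((z.1 * F, psi z.1) : KE).
    rewrite sum_dual /=; congr pair.
      rewrite -[LHS]mulr1 -t1 mulr_sumr; apply: eq_bigr => z _; ring.
    by rewrite mulr_sumr; apply: eq_bigr => z _; ring.
  rewrite big_seq; elim/big_ind: _ => // [x y Ix Iy|z /ht[z1 z2]].
    by have := Ilin 1 x y (conj (twist1 bh) (twist0 bh 0)) Ix Iy; rewrite mul1r.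
  rewrite -[_ * _]addr0; apply: Ilin => //; last exact: Ipsi.
  by split; [rewrite /regular -(addNr d%:Z); exact: twistM | exact: twist0].
have /(deformation_fibre _ bh)[y Iy] := vanishing_mul f hv.
have := Ilin 1 _ _ (conj (twist1 bh) (twist0 bh 0)) Iu (ideal_eps bh Iy).
by rewrite mul1r; congr I; congr pair; rewrite /= addr0.
Qed.

Definition equation_section (h : P) : K :=
  if pselect (basic_open h) is left bh then projT1 (cid (local_equation bh)) else 0.

Lemma equation_section_twist h : basic_open h -> twist h d (equation_section h).
Proof.
by rewrite /equation_section => bh; case: pselect => // bh'; case: cid => s [].
Qed.

Lemma equation_section_ideal h u v : basic_open h ->
  twist h (- d%:Z) u -> twist h (- d%:Z) v ->
  I h (u * F, u * equation_section h + v * F).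
Proof.
rewrite /equation_section => bh; case: pselect => // bh'.
by case: cid => /= s [_ Is] hu hv; exact: Is.
Qed.

Lemma ideal_difference h x y z : basic_open h ->
  I h (x, y) -> I h (x, z) -> vanishing f d h 0 (y - z).
Proof.
move=> bh Iy Iz; apply: deformation_kernel => //.
have [I0 IS Ilin] := deformation_is_ideal bh.
have S1 : regular_eps h ((-1, 0) : KE).
  by split; [apply: twistN => //; exact: twist1 | exact: twist0].
have := Ilin _ _ _ S1 Iz Iy; congr I; congr pair => /=; ring.
Qed.

Lemma equation_section_same : same_subscheme I (deformation_of f d equation_section).
Proof.
move=> h [x y] bh; split=> [Ixy|/deformation_ofP[u [v [hu hv -> ->]]]]; last first.
  exact: equation_section_ideal.
have /vanishing_ideal[u hu xE] : vanishing f d h 0 x.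
  by apply/deformation_fibre => //; exists y.
have := equation_section_ideal bh hu (twist0 bh _); rewrite mul0r addr0 -xE => Iu.
have /vanishing_ideal[v hv yE] := ideal_difference bh Ixy Iu.
by apply/deformation_ofP; exists u, v; split=> //; rewrite -yE addrC subrK.
Qed.

Lemma equation_section_normal : normal_section f d equation_section.
Proof.
split=> [h|h g bh bg]; first exact: equation_section_twist.
have bhg := basic_openM bh bg.
have incl k x : twist h k x -> twist (h * g) k x by exact: twist_restr.
apply: (vanishing_locally bh bhg incl char0) => u hu.
rewrite mulrBr; apply: (ideal_difference (x := u * F) bhg).
  have := equation_section_ideal bhg (incl _ _ hu) (twist0 bhg _).
  by rewrite mul0r addr0.
have := equation_section_ideal bh hu (twist0 bh _); rewrite mul0r addr0 => Iu.
have [_ span] := closedI; apply/(span _ _ _ bh bg).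
exists [:: (1, (u * F, u * equation_section h))]; last by rewrite big_seq1 mul1r.
move=> z; rewrite inE => /eqP-> /=; split=> //.
by split; [exact: twist1 | exact: twist0].
Qed.

End EquationSection.

(** A trivialization over D+(h) has the form x |-> x - eps D x modulo the
    ideal of the trivial deformation, with D a derivation modulo the ideal of
    X. It sends u f + eps u s into that ideal, which means D (u f) = u s on
    X. *)
Lemma trivial_over_vector_field (s : P -> K) h i : (0 < d)%N ->
  normal_section f d s -> basic_open h ->
  trivial_over f d h (deformation_of f d s) ->
  exists D, vector_field (h * 'X_i) D /\ normal_image f d D (h * 'X_i) (s (h * 'X_i)).
Proof.
move=> d0 hs bh [th [thS [thD thM thC] thI _ th1]].
have [_ [e e0 hh]] := bh.
have bX := @basic_openX C n i; have bhX := basic_openM bh bX.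
have [c0 hc hc'] := variable_unit i bh e0 hh.
set c := _ / _ in c0 hc hc'.
(* th (x, 0) is congruent to x - eps (D x). *)
pose D (x : K) : K := - (th (x, 0)).2.
have QD := @vanishingD _ _ f d h bh 0; have QN := @vanishingN _ _ f d h bh 0.
have QB := @vanishingB _ _ f d h bh 0; have QM := @vanishingMr _ _ f d h bh 0.
have reg0 : regular h (0 : K) := twist0 bh 0.
have S0 (x : K) : regular h x -> regular_eps h ((x, 0) : KE) by [].
have thS1 x : regular h x -> regular h (th (x, 0)).1 by move/S0/thS => [].
have thS2 x : regular h x -> regular h (th (x, 0)).2 by move/S0/thS => [].
have th1' x : regular h x -> vanishing f d h 0 ((th (x, 0)).1 - x).
  by move/S0/th1.
have pairD (x y : K) : (x + y, 0) = ((x, 0) : KE) + ((y, 0) : KE).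
  by congr pair; rewrite addr0.
have pairM (x y : K) : (x * y, 0) = ((x, 0) : KE) * ((y, 0) : KE).
  by congr pair; rewrite /= mulr0 mul0r addr0.
have DD x y : regular h x -> regular h y ->
    vanishing f d h 0 (D (x + y) - (D x + D y)).
  move=> hx hy; have [_ /= /QN] := thD _ _ (S0 _ hx) (S0 _ hy).
  by rewrite -pairD; congr vanishing; rewrite /D; ring.
have DM x y : regular h x -> regular h y ->
    vanishing f d h 0 (D (x * y) - (x * D y + y * D x)).
  move=> hx hy; have [_ /= HM] := thM _ _ (S0 _ hx) (S0 _ hy).
  rewrite -pairM in HM.
  have := QB _ _ (QB _ _ (QN _ HM) (QM _ _ (thS2 _ hy) (th1' _ hx)))
     (QM _ _ (thS2 _ hx) (th1' _ hy)).
  by congr vanishing; rewrite /D; ring.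
have DC (a : C) : vanishing f d h 0 (D (ofpoly a%:MP)).
  have [_ /= /QN] := thC (scal a).
  by rewrite /constant_eps /= rmorph0 subr0.
pose u := c ^+ d.
have hu : twist h (- d%:Z) u by rewrite -mulrN1; exact: twistXn.
have hF : regular h (u * F).
  by rewrite /regular -(addNr d%:Z); apply: twistM => //; exact/twist_poly/zhomog_dhomog.
have hus : regular h (u * s h).
  by rewrite /regular -(addNr d%:Z); apply: twistM => //; case: hs => + _; apply.
have Dt : vanishing f d h 0 (D (u * F) - u * s h).
  (* As th is linear over C[eps] up to the trivial ideal, th (eps u s) is eps
     u s. *)
  pose w : KE := (0, u * s h).
  have Sw : regular_eps h w by [].
  pose ce : KE := constant_eps n (eps C).
  have ceE : ce = (0, 1) by congr pair; rewrite /= ?rmorph0 // rmorph1.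
  have Sce : regular_eps h ce by rewrite ceE; split; [exact: reg0 | exact: twist1].
  have wE : w = ce * ((u * s h, 0) : KE).
    by rewrite ceE; congr pair; rewrite /= ?mul0r ?mul1r ?add0r.
  have [_ /= Hw] := thM _ _ Sce (S0 _ hus); rewrite -wE in Hw.
  have [/= Hc1 Hc2] := thC (eps C); rewrite -/ce ceE /= subr0 in Hc1 Hc2.
  have wclose : vanishing f d h 0 ((th w).2 - u * s h).
    have H1 := QM _ _ (thS2 _ hus) Hc1; have H2 := QM _ _ (thS1 _ hus) Hc2.
    have := QD _ _ (QD _ _ (QD _ _ Hw H1) H2) (th1' _ hus).
    by congr vanishing; rewrite ceE; ring.
  have Iw : deformation_of f d s h (u * F, u * s h).
    by apply/deformation_ofP; exists u, 0; rewrite mul0r addr0; split=> //; exact: twist0.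
  have SFw : regular_eps h ((u * F, u * s h) : KE) by [].
  have [_ /= HF] := (thI _ SFw).1 Iw.
  have [_ /= HD] := thD _ _ (S0 _ hF) Sw.
  have sumE : ((u * F, 0) : KE) + w = (u * F, u * s h).
    by congr pair; rewrite /= ?addr0 ?add0r.
  rewrite sumE in HD.
  have := QD _ _ (QB _ _ HD HF) wclose.
  by congr vanishing; rewrite /D; ring.
have incl k x : twist h k x -> twist (h * 'X_i) k x by exact: twist_restr.
have loc := local_form d0 hf bh bhX incl c0 hc hc' DD DM DC Dt.
set a := (fun j => _) in loc.
have ha j : twist (h * 'X_i) 1 (a j).
  rewrite /a -[1]addr0; apply: twistM => //; apply: incl.
  apply: twistN => //; apply: thS2.
  exact: (twistM bh hc (twist_var bh j)).
exists (der a); split; first exact: der_vector_field.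
apply: normal_image_der => //.
have := vanishingB bhX loc (normal_section_restr hs bh bX).
by congr vanishing; ring.
Qed.

Lemma proj_point_degree (p : P -> Prop) : proj_point p -> p f -> (0 < d)%N.
Proof.
move=> [[p0 plin] [p1 _] _ _] pf; rewrite lt0n; apply/eqP => d0; apply: p1.
have [c fE] : exists c, f = c%:MP by apply: homog0_constant; move: hf; rewrite d0.
have c0 : c != 0 by apply: contraNneq f0 => c0; rewrite fE c0 mpolyC0.
have := plin f 0 (c^-1)%:MP pf p0.
by rewrite fE -mpolyCM mulVf // mpolyC1 addr0.
Qed.

Theorem locally_trivial_has_section I : locally_trivial_deformation f d I ->
  exists2 s, H0_N' f d s & same_subscheme I (deformation_of f d s).
Proof.
move=> [defI loc]; exists (equation_section defI); last exact: equation_section_same.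
have hs := equation_section_normal defI.
split=> // p pp pf; have d0 := proj_point_degree pp pf.
have [h [bh ph] triv] := loc p pp pf.
have [_ [_ pprime] _ [i pX]] := pp.
have triv' : trivial_over f d h (deformation_of f d (equation_section defI)).
  move: triv => [th [H1 H2 H3 H4 H5]]; exists th; split=> // x Sx.
  rewrite -H3 //; split=> /(equation_section_same defI x bh) //.
have [D [vD im]] := trivial_over_vector_field i d0 hs bh triv'.
exists (h * 'X_i), D; split=> //; first exact: (basic_openM bh (basic_openX _ i)).
by move=> /pprime[].
Qed.

End FromDeformations.

(** * Cech cohomology of O and global vector fields *)

Section GlobalSections.
Variables (C : fieldType) (n : nat).
Local Notation P := {mpoly C[n]}.
Local Notation K := (ratfun C n).
Local Notation of_poly := (@ofpoly C n).
Implicit Types (h g : P) (i j k : 'I_n).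

Lemma global_section i j (l : nat) (x : K) : i != j ->
  twist 'X_i l x -> twist 'X_j l x -> exists2 p : P, p \is l.-homog & x = ofpoly p.
Proof.
move=> ij hi hj.
have [p hp ->] : exists2 p, zhomog l p & x = ofpoly p.
  apply: twist1_poly; apply: (twist_cap (oner_neq0 _) (dhomog1 _ _) _ ij).
  - by rewrite orbC.
  - by rewrite mul1r.
  - by rewrite mul1r.
by exists p => //; apply/zhomog_dhomog.
Qed.

(** This is the vanishing of H^1(P^r, O). A monomial of u1 with negative
    exponents of both X_i and X_j would occur in u2, which has no pole along
    X_j, or in u1 - u2, which has no pole along X_i; hence u1 splits. *)
Lemma cech_H1 i j k (u1 u2 : K) : i != j -> k != i -> k != j ->
    twist ('X_i * 'X_j) 0 u1 -> twist ('X_i * 'X_k) 0 u2 ->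
    twist ('X_j * 'X_k) 0 (u1 - u2) ->
  exists v, twist 'X_i 0 v /\ twist 'X_j 0 (u1 + v).
Proof.
move=> ij ki kj.
have bX a := @basic_openX C n a.
have den a b := @twist_den _ _ ('X_a * 'X_b) 2 (mulf_neq0 (proj1 (bX a)) (proj1 (bX b)))
   (dhomogM (var_homog C a) (var_homog C b)).
move=> /den[N1 H1] /den[N2 H2] /den[N3 H3].
set N := maxn N1 (maxn N2 N3).
have [|p hp E1] := H1 N; first exact: leq_maxl.
have [|q hq E2] := H2 N; first by rewrite /N; lia.
have [|r hr E3] := H3 N; first by rewrite /N; lia.
rewrite add0r in hp.
have XN a : ofpoly ('X_a : P) ^+ N != 0 := expf_neq0 N (basic_open_neq0 (bX a)).
have clear_den (L : fieldType) (a b c p' q' r' : L) : a != 0 -> b != 0 -> c != 0 ->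
    p' / (a * b) - q' / (a * c) = r' / (b * c) -> c * p' = b * q' + a * r'.
  move=> a0 b0 c0 E.
  have -> : r' = (b * c) * (r' / (b * c)) by field; rewrite b0 c0.
  by rewrite -E; field; rewrite a0 b0 c0.
have E : 'X_k ^+ N * p = 'X_j ^+ N * q + 'X_i ^+ N * r.
  apply: ofpoly_inj; rewrite !rmorphD !rmorphM !rmorphXn /=.
  apply: clear_den (XN i) (XN j) (XN k) _.
  by rewrite -!exprMn -!rmorphM /= -E1 -E2 -E3.
have [q' [r' pE]] := mem_variable_ideal kj ki E.
have hp2 : p \is (N + N).-homog.
  by apply/zhomog_dhomog; rewrite addnn -muln2.
have {}pE : p = 'X_j ^+ N * pihomog mdeg N q' + 'X_i ^+ N * pihomog mdeg N r'.
  rewrite -{1}(pihomog_dE hp2) {1}pE raddfD /=.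
  by rewrite (pihomogM _ _ (dhomogXn _ j N)) (pihomogM _ _ (dhomogXn _ i N)).
have tw a (b : P) : b \is N.-homog -> twist 'X_a 0 (ofpoly b / ofpoly 'X_a ^+ N).
  move=> hb; rewrite -(subrr N%:Z); apply: twistM => //.
    exact/twist_poly/zhomog_dhomog.
  rewrite -exprVn -mulrN1; apply: twistXn => //.
  exact: (twist_inv (bX a) (var_homog C a)).
(* The part of u1 that has a pole along X_i is moved to the other side. *)
exists (- (ofpoly (pihomog mdeg N q') / ofpoly 'X_i ^+ N)); split.
  by apply: twistN => //; apply: tw; exact: pihomogP.
have -> : u1 - ofpoly (pihomog mdeg N q') / ofpoly 'X_i ^+ N =
    ofpoly (pihomog mdeg N r') / ofpoly 'X_j ^+ N.
  rewrite E1 pE rmorphM rmorphD !rmorphM !rmorphXn /= exprMn.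
  have cancel_den (L : fieldType) (a b x y : L) : a != 0 -> b != 0 ->
      (b * x + a * y) / (a * b) - x / a = y / b.
    by move=> a0 b0; field; rewrite a0 b0.
  exact: cancel_den (XN i) (XN j).
by apply: tw; exact: pihomogP.
Qed.

End GlobalSections.

Section VectorFields.
Variables (C : fieldType) (n : nat).
Local Notation P := {mpoly C[n]}.
Local Notation K := (ratfun C n).
Local Notation x j := (ofpoly ('X_j : P)).
Implicit Types (h g : P) (i j k : 'I_n).

(** The derivation of functions on D+(X_k) lifts to forms, as the derivation
    that has this value on X_j and 0 on X_k. *)
Definition lift_coef (D : P -> K -> K) (k j : 'I_n) : K :=
  x k * D 'X_k (x j / x k).

Lemma ratio_regular k j : regular 'X_k (x j / x k).
Proof.
have bX := @basic_openX C n k.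
exact: (twistM bX (twist_var bX j) (twist_inv bX (var_homog C k))).
Qed.

Lemma lift_coef_twist D k j : global_vector_field D ->
  twist 'X_k 1 (lift_coef D k j).
Proof.
move=> [vD _]; have bX := @basic_openX C n k.
have := twistM bX (twist_var bX k) (vector_field_regular (vD _ bX) (ratio_regular k j)).
by [].
Qed.

(** Two lifts to forms of the same vector field differ by a multiple of the
    Euler field, the derivation with value X_j on X_j. *)
Lemma lift_coef_change D k l j : global_vector_field D ->
  lift_coef D k j = lift_coef D l j + x j * (lift_coef D k l / x l).
Proof.
move=> [vD comp]; have bX a := @basic_openX C n a.
have bkl := basic_openM (bX k) (bX l).
have Dk a : D ('X_k * 'X_l) (x a / x k) = D 'X_k (x a / x k).
  by apply: comp; rewrite //; exact: ratio_regular.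
have Dl a : D ('X_k * 'X_l) (x a / x l) = D 'X_l (x a / x l).
  by rewrite mulrC; apply: comp => //; exact: ratio_regular.
have X0 a := basic_open_neq0 (bX a).
have rk : regular ('X_k * 'X_l) (x l / x k).
  by apply: twist_restr => //; exact: ratio_regular.
have rl : regular ('X_k * 'X_l) (x j / x l).
  by apply: twist_restrl => //; exact: ratio_regular.
have := vector_fieldM (vD _ bkl) rl rk.
have -> : x j / x l * (x l / x k) = x j / x k by rewrite mulrA (divfK (X0 l)).
rewrite !Dk Dl /lift_coef => ->.
have expand (L : fieldType) (a b c u v : L) : a != 0 -> b != 0 ->
    a * (c / b * u + b / a * v) = b * v + c * (a * u / b).
  by move=> a0 b0; field; rewrite a0 b0.
exact: expand (X0 k) (X0 l).
Qed.

(** The multiples of the Euler field by which the lifts over the D+(X_k)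
    differ form a Cech cocycle of O. It is a coboundary, so that the lifts can
    be corrected to agree; their coefficients are then global sections of
    O(1), that is, linear forms. *)
Lemma global_vector_field_linear (D : P -> K -> K) i j k :
    i != j -> k != i -> k != j -> global_vector_field D ->
  exists a : 'I_n -> P, (forall l, a l \is 1.-homog) /\
    (forall u, (u == i) || (u == j) -> exists2 c, twist 'X_u 0 c &
       forall l, lift_coef D u l = ofpoly (a l) + c * x l).
Proof.
move=> ij ki kj gD; have bX a := @basic_openX C n a.
have X0 a := basic_open_neq0 (bX a).
pose gam u v : K := lift_coef D u v / x v.
have hgam u v : twist ('X_u * 'X_v) 0 (gam u v).
  apply: (twistM (k := 1) (l := -1) (basic_openM (bX u) (bX v))).
    by apply: twist_restr => //; exact: lift_coef_twist.
  by apply: twist_restrl => //; apply: (twist_inv (bX v)); exact: var_homog.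
have chg u v l : lift_coef D u l = lift_coef D v l + x l * gam u v.
  exact: lift_coef_change.
have cocycle : gam i j - gam i k = - gam j k.
  have := chg i k k; rewrite {1}(chg i j k) (chg j k k) -!addrA => /addrI/eqP.
  rewrite -mulrDr => /eqP/(mulfI (X0 k)) <-; ring.
have [v [hv hv1]] : exists v, twist 'X_i 0 v /\ twist 'X_j 0 (gam i j + v).
  apply: (cech_H1 ij ki kj (hgam i j) (hgam i k)); rewrite cocycle.
  by apply: twistN => //; exact: basic_openM.
have aE l : exists2 a : P, a \is 1.-homog & lift_coef D i l + x l * v = ofpoly a.
  apply: (global_section (l := 1) ij).
    apply: twistD => //; first exact: lift_coef_twist.
    rewrite -[1%:Z]addr0; apply: twistM => //; exact: twist_var.
  rewrite (chg i j l) -addrA -mulrDr; apply: twistD => //; first exact: lift_coef_twist.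
  rewrite -[1%:Z]addr0; apply: twistM => //; exact: twist_var.
pose a l := projT1 (cid2 (aE l)).
have ha l : a l \is 1.-homog by rewrite /a; case: cid2.
have haE l : lift_coef D i l + x l * v = ofpoly (a l) by rewrite /a; case: cid2.
exists a; split=> // u /orP[/eqP->|/eqP->].
  by exists (- v) => [|l]; [exact: twistN | rewrite -haE; ring].
exists (- (gam i j + v)) => [|l]; first exact: twistN.
by rewrite -haE (chg i j l); ring.
Qed.

End VectorFields.

(** * The subspaces of sections to compare *)

Section NormalSections.
Variables (C : fieldType) (n : nat) (f : {mpoly C[n]}) (d : nat).
Local Notation P := {mpoly C[n]}.
Local Notation K := (ratfun C n).
Local Notation F := (ofpoly f).
Local Notation x j := (ofpoly ('X_j : P)).
Local Notation form g := (@form_section C n g).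
Implicit Types (h g : P) (i j k : 'I_n) (s t : P -> K).
Hypotheses (char0 : [pchar C] =i pred0) (hf : f \is d.-homog) (f0 : f != 0).

(** A monomial of large degree is divisible by a large power of some
    variable. *)
Lemma jacobian_sat_variables g :
  jacobian_sat f g <-> forall i, exists M, jacobian_ideal f ('X_i ^+ M * g).
Proof.
have [J0 Jlin] := jacobian_idealP f.
split=> [[k hk] i|hM].
  by exists k; rewrite mpolyXn; apply: hk; rewrite mdegMn mdeg1 mul1n.
pose M i := projT1 (cid (hM i)).
have JM i : jacobian_ideal f ('X_i ^+ M i * g) by rewrite /M; case: cid.
(* If each exponent m i is below M i then the degree of m is at most the sum
   of the M i. *)
exists (\sum_i M i).+1 => m hm.
have [i Mi] : exists i, (M i <= m i)%N.
  apply: contrapT => no.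
  have : (mdeg m <= \sum_i M i)%N.
    rewrite mdegE; apply: leq_sum => i _; rewrite leqNgt; apply/negP => lt.
    by apply: no; exists i; exact: ltnW.
  by rewrite hm ltnn.
have -> : 'X_[m] * g = 'X_[m - U_(i) *+ M i] * ('X_i ^+ M i * g) + 0.
  by rewrite addr0 mulrA mpolyXn -mpolyXD submK // le_pow_mnm.
by apply: Jlin => //; exact: JM.
Qed.

Lemma normal_section_degree0 s : d = 0%N -> normal_section f d s ->
  zero_section f d s.
Proof.
move=> d0 [hs _] h bh; have F0 := ofpoly_neq0 f0.
have f00 : f \is 0.-homog by move: hf; rewrite d0.
have := hs h bh; rewrite d0 => hsh.
exists (s h / F); last by rewrite (divfK F0).
rewrite -[0%:Z - 0%:Z]addr0 oppr0 addr0; apply: (twistM (k := 0) (l := 0) bh hsh).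
have [c fE] := homog0_constant f00.
have c0 : c != 0 by apply: contraNneq f0 => c0; rewrite fE c0 mpolyC0.
suff -> : F^-1 = ofpoly (c^-1)%:MP by exact: twistC.
apply: (mulfI F0); rewrite (divff F0) fE.
by rewrite -rmorphM -mpolyCM (divff c0) mpolyC1 rmorph1.
Qed.

Lemma normal_section_form g : g \is d.-homog -> normal_section f d (form g).
Proof.
move=> hg; split=> [h bh|h h' bh bh']; first exact/twist_poly/zhomog_dhomog.
by rewrite subrr; apply: vanishing0; exact: basic_openM.
Qed.

Lemma normal_section0 : normal_section f d (0 : P -> K).
Proof.
split=> [h bh|h g bh bg]; first exact: twist0.
by rewrite subrr; apply: vanishing0; exact: basic_openM.
Qed.

Lemma normal_sectionP (a : C) s t : normal_section f d s -> normal_section f d t ->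
  normal_section f d (a *: s + t).
Proof.
move=> [hs cs] [ht ct]; split=> [h bh|h h' bh bh'].
  have -> : (a *: s + t) h = a *: s h + t h by [].
  by apply: twistD; [| apply: twistZ => //; exact: hs | exact: ht].
have -> : (a *: s + t) (h * h') - (a *: s + t) h =
  a *: (s (h * h') - s h) + (t (h * h') - t h).
  transitivity ((a *: s (h * h') + t (h * h')) - (a *: s h + t h)); first by [].
  by rewrite scalerBr opprD addrACA.
have bhh := basic_openM bh bh'.
by apply: vanishingD => //; [apply: vanishingZ => //; exact: cs | exact: ct].
Qed.

Lemma normal_image_zero h s : basic_open h -> vanishing f d h d (s h) ->
  normal_image f d (fun=> 0) h (s h).
Proof.
move=> bh hs u hu; rewrite sub0r; apply: vanishingN => //.
by rewrite -(addNr d%:Z); exact: vanishingM.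
Qed.

Lemma zero_vector_field : global_vector_field (fun (_ : P) (_ : K) => 0 : K).
Proof.
split=> // h bh; split=> [z _|c z w _ _|z w _ _]; first exact: twist0.
  by rewrite scaler0 addr0.
by rewrite !mulr0 addr0.
Qed.

Lemma zero_section_image s : normal_section f d s -> zero_section f d s ->
  image_H0_T f d s.
Proof.
move=> hs s0; split=> //; exists (fun _ _ => 0); first exact: zero_vector_field.
by move=> h bh; apply: normal_image_zero => //; exact: s0.
Qed.

(** By [local_form] the vector fields over some D+(h) can be replaced by
    derivations of the function field, over a smaller open set. Derivations
    restrict to smaller open sets, while a vector field over D+(h) is a map on
    functions over D+(h) only. *)
Lemma H0_N'_derivation s : H0_N' f d s <-> normal_section f d s /\
  forall p, proj_point p -> p f -> exists h (a : 'I_n -> K),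
    [/\ basic_open h, ~ p h, forall j, twist h 1 (a j)
      & vanishing f d h d (der a F - s h)].
Proof.
split=> [[hs loc]|[hs loc]]; split=> // p pp pf; last first.
  have [h [a [bh ph ha hv]]] := loc p pp pf.
  exists h, (der a); split=> //; first exact: der_vector_field.
  exact: normal_image_der.
have d0 := proj_point_degree hf f0 pp pf.
have [h [D [bh ph vD im]]] := loc p pp pf.
have [_ [_ pprime] _ [i pX]] := pp; have [_ [e e0 hh]] := bh.
have bX := @basic_openX C n i; have bhX := basic_openM bh bX.
have [c0 hc hc'] := variable_unit i bh e0 hh.
set c := _ / _ in c0 hc hc'.
have incl (k : int) y : twist h k y -> twist (h * 'X_i) k y by exact: twist_restr.
have v0 := vanishing0 f d bh 0.
have hu : twist h (- d%:Z) (c ^+ d) by rewrite -mulrN1; exact: twistXn.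
have DD y z : regular h y -> regular h z -> vanishing f d h 0 (D (y + z) - (D y + D z)).
  by move=> hy hz; rewrite (vector_fieldD vD) // subrr.
have DM y z : regular h y -> regular h z ->
    vanishing f d h 0 (D (y * z) - (y * D z + z * D y)).
  by move=> hy hz; rewrite (vector_fieldM vD) // subrr.
have DC (b : C) : vanishing f d h 0 (D (ofpoly b%:MP)).
  by rewrite (vector_fieldC bh vD).
have loc_form := local_form d0 hf bh bhX incl c0 hc hc' DD DM DC (im _ hu).
eexists (h * 'X_i), _; split; last first.
- have := vanishingB bhX loc_form (normal_section_restr hs bh bX).
  rewrite opprB addrA subrK; exact.
- move=> j; rewrite -[1]addr0; apply: twistM => //; apply: incl.
  apply: (vector_field_regular vD).
  exact: (twistM bh hc (twist_var bh j)).
- by move=> /pprime[].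
- exact: bhX.
Qed.

(** Local derivations for s and t, over D+(h) and D+(g), are combined over
    D+(hg). *)
Lemma H0_N'_subspace : subspace (H0_N' f d).
Proof.
split.
  apply/H0_N'_derivation; split; first exact: normal_section0.
  move=> p [_ _ _ [i pX]] pf; exists 'X_i, (fun=> 0).
  have bX := @basic_openX C n i; split=> //; first by move=> j; exact: twist0.
  rewrite /der big1 ?subr0; first exact: vanishing0.
  by move=> j _; rewrite mul0r.
move=> a s t /H0_N'_derivation[hs ls] /H0_N'_derivation[ht lt].
apply/H0_N'_derivation; split; first exact: normal_sectionP.
move=> p pp pf; have [h [u [bh ph hu hE]]] := ls p pp pf.
have [g [v [bg pg hv gE]]] := lt p pp pf.
have [_ [_ pprime] _ _] := pp; have bhg := basic_openM bh bg.
exists (h * g), (fun j => a *: u j + v j); split=> //.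
- by move=> /pprime[].
- move=> j; apply: twistD => //; last exact: twist_restrl.
  by apply: twistZ => //; exact: twist_restr.
have := vanishingB bhg (vanishing_restr bh bg hE) (normal_section_restr hs bh bg).
rewrite opprB addrA subrK => /(vanishingZ bhg a) H1.
have Ht : vanishing f d (h * g) d (t (h * g) - t g).
  by rewrite mulrC; exact: normal_section_restr.
have := vanishingB bhg (vanishing_restrl bh bg gE) Ht.
rewrite opprB addrA subrK => H2.
have -> : der (fun j => a *: u j + v j) F - (a *: s + t) (h * g) =
  a *: (der u F - s (h * g)) + (der v F - t (h * g)).
  transitivity (der (fun j => a *: u j + v j) F - (a *: s (h * g) + t (h * g))) => //.
  have -> : der (fun j => a *: u j + v j) F = a *: der u F + der v F.
    rewrite /der scaler_sumr -big_split; apply: eq_bigr => j _ /=.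
    by rewrite !ratfun_scaleE; ring.
  by rewrite scalerBr opprD addrACA.
exact: vanishingD.
Qed.

Lemma image_H0_T_subspace : subspace (image_H0_T f d).
Proof.
split.
  apply: zero_section_image => [|h bh]; last exact: vanishing0.
  exact: normal_section0.
move=> a s t [hs [D [vD cD] imD]] [ht [E [vE cE] imE]].
split; first exact: normal_sectionP.
exists (fun h z => a *: D h z + E h z).
  split=> [h bh|h g z bh bg hz]; last by rewrite cD ?cE.
  have [rD lD mD] := vD h bh; have [rE lE mE] := vE h bh.
  split=> [z hz|c z w hz hw|z w hz hw].
  - by apply: twistD => //; [apply: twistZ => //; exact: rD | exact: rE].
  - by rewrite lD // lE // !ratfun_scaleE; ring.
  - by rewrite mD // mE // !ratfun_scaleE; ring.
move=> h bh u hu.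
have := vanishingD bh (vanishingZ bh a (imD h bh u hu)) (imE h bh u hu).
congr vanishing.
transitivity (a *: D h (u * F) + E h (u * F) - u * (a *: s h + t h)) => //.
by rewrite !ratfun_scaleE; ring.
Qed.

Lemma image_H0_T_sub s : image_H0_T f d s -> H0_N' f d s.
Proof.
move=> [hs [D [vD cD] imD]]; split=> // p [_ _ _ [i pX]] _.
have bX := @basic_openX C n i; exists 'X_i, (D 'X_i); split=> //.
  exact: vD.
exact: imD.
Qed.

Lemma Jsat_deg_subspace : subspace (Jsat_deg f d).
Proof.
have [J0 Jlin] := jacobian_idealP f.
split; first by split; [exact: dhomog0 | exists 0%N => m _; rewrite mulr0].
move=> a u v [hu /jacobian_sat_variables su] [hv /jacobian_sat_variables sv].
split; first by apply: dhomogD => //; exact: dhomogZ.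
apply/jacobian_sat_variables => i; have [M Ju] := su i; have [N Jv] := sv i.
exists (M + N)%N.
have -> : 'X_i ^+ (M + N) * (a *: u + v) =
  (a%:MP * 'X_i ^+ N) * ('X_i ^+ M * u) + ('X_i ^+ M * ('X_i ^+ N * v) + 0).
  by rewrite -mul_mpolyC exprD addr0; ring.
by apply: (Jlin) => //; exact: Jlin.
Qed.

Lemma J_deg_subspace : subspace (J_deg f d).
Proof.
have [J0 Jlin] := jacobian_idealP f.
split; first by split; [exact: dhomog0 | ].
move=> a u v [hu Ju] [hv Jv]; split; first by apply: dhomogD => //; exact: dhomogZ.
by rewrite -mul_mpolyC; exact: Jlin.
Qed.

Lemma J_deg_sub g : J_deg f d g -> Jsat_deg f d g.
Proof.
have [J0 Jlin] := jacobian_idealP f.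
move=> [hg Jg]; split=> //; exists 0%N => m _.
by rewrite -[_ * g]addr0; exact: Jlin.
Qed.

Lemma form_section_linear : linear (@form_section C n).
Proof.
move=> a u v; apply/funext => h.
rewrite -[RHS]/(a *: ofpoly u + ofpoly v : K) -[LHS]/(ofpoly (a *: u + v)).
by rewrite -mul_mpolyC rmorphD rmorphM.
Qed.

Lemma mem_jacobian_deg : (0 < d)%N -> jacobian_ideal f f.
Proof. by move=> d0; apply: (mem_jacobian hf); rewrite ((pcharf0P C).1 char0) -lt0n. Qed.

Lemma jacobian_sum (a : 'I_n -> P) :
  ofpoly (\sum_(i < n) a i * f^`M(i)) = der (fun i => ofpoly (a i)) F.
Proof. by rewrite der_poly rmorph_sum; apply: eq_bigr => i _; rewrite rmorphM. Qed.

Lemma J_deg_image g : J_deg f d g -> image_H0_T f d (form g).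
Proof.
move=> [hg Jg]; split; first exact: normal_section_form.
have [a ha gE] : exists2 a : 'I_n -> P, forall i, a i \is 1.-homog
    & g = \sum_(i < n) a i * f^`M(i).
  case: (posnP d) => [d0|d0].
    exists (fun=> 0) => [i|]; first exact: dhomog0.
    move: Jg => [a ->]; apply: eq_bigr => i _.
    by rewrite mderiv_homog0 ?mulr0 //; move: hf; rewrite d0.
  have [a ha ->] := jacobian_homog_coef hf (leq_pred d) hg Jg.
  by exists a => // i; have -> : 1%N = (d - d.-1)%N by lia.
pose b i : K := ofpoly (a i).
have hb h : basic_open h -> forall i, twist h 1 (b i).
  by move=> bh i; apply: (twist_poly bh); exact/(zhomog_dhomog 1).
exists (fun=> der b).
  by split=> // h bh; apply: der_vector_field => //; exact: hb.
move=> h bh; apply: normal_image_der => //; first exact: hb.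
rewrite /form_section gE jacobian_sum subrr; exact: vanishing0.
Qed.

(** If X_i^M g is the sum of the a_j f_j, where f_j is the derivative of f
    with respect to X_j, the derivation with coefficients a_j / X_i^M maps f
    to g over D+(X_i). *)
Lemma Jsat_deg_H0_N' g : Jsat_deg f d g -> H0_N' f d (form g).
Proof.
move=> [hg /jacobian_sat_variables sat]; apply/H0_N'_derivation.
split; first exact: normal_section_form.
move=> p pp pf; have d0 := proj_point_degree hf f0 pp pf.
have [_ _ _ [i pX]] := pp; have [M JM] := sat i.
have bX := @basic_openX C n i; have X0 := basic_open_neq0 bX.
have hM : 'X_i ^+ M * g \is (M + d).-homog by apply: dhomogM => //; exact: dhomogXn.
have [|a ha gE] := jacobian_homog_coef hf _ hM JM; first by lia.
pose b j : K := (x i)^-1 ^+ M * ofpoly (a j).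
exists 'X_i, b; split=> // [j|].
  rewrite (_ : 1 = M%:Z * - 1%:Z + (M + d - d.-1)%N%:Z); last by lia.
  apply: twistM => //; first by apply: twistXn => //; exact: (twist_inv bX (var_homog C i)).
  exact/twist_poly/zhomog_dhomog.
have -> : der b F = (x i)^-1 ^+ M * der (fun j => ofpoly (a j)) F.
  by rewrite /der mulr_sumr; apply: eq_bigr => j _; rewrite /b; ring.
rewrite -jacobian_sum -gE rmorphM rmorphXn mulrA -exprMn (mulVf X0) expr1n mul1r.
by rewrite subrr; exact: vanishing0.
Qed.

End NormalSections.

(** * The isomorphism with the local cohomology of the jacobian ring *)

Section JacobianCohomology.
Variables (C : fieldType) (n : nat) (f : {mpoly C[n]}) (d : nat).
Local Notation P := {mpoly C[n]}.
Local Notation K := (ratfun C n).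
Local Notation F := (ofpoly f).
Local Notation x j := (ofpoly ('X_j : P)).
Local Notation form g := (@form_section C n g).
Implicit Types (h g : P) (i j : 'I_n) (s t : P -> K).
Hypotheses (char0 : [pchar C] =i pred0) (hf : f \is d.-homog) (f0 : f != 0).

Lemma Jsat_deg_degree0 g : d = 0%N -> (0 < n)%N -> Jsat_deg f d g -> g = 0.
Proof.
move=> d0 n0 [_ /jacobian_sat_variables sat]; have [M [a E]] := sat (Ordinal n0).
have : 'X_(Ordinal n0) ^+ M * g = 0.
  rewrite E big1 // => i _; rewrite mderiv_homog0 ?mulr0 //.
  by move: hf; rewrite d0.
move/eqP; rewrite mulf_eq0 => /orP[|/eqP //].
by rewrite expf_eq0 (negPf (proj1 (basic_openX _ _))) andbF.
Qed.

(** The lift of the vector field to forms maps f to the sum of the a_j f_j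
    plus c d f, by Euler's identity, and to g modulo f. *)
Lemma image_form_at D g k (a : 'I_n -> P) (c : K) : (0 < d)%N ->
    global_vector_field D -> normal_image f d (D 'X_k) 'X_k (ofpoly g) ->
    twist 'X_k 0 c -> (forall l, lift_coef D k l = ofpoly (a l) + c * x l) ->
  exists2 y, twist 'X_k 0 y & ofpoly (\sum_(j < n) a j * f^`M(j) - g) = y * F.
Proof.
move=> d0 [vD _] im hc aE; have bX := @basic_openX C n k.
have X0 := basic_open_neq0 bX; have vDk := vD _ bX.
have hX : twist 'X_k (- 1) (x k)^-1 := twist_inv bX (var_homog C k).
have v0 := vanishing0 f d bX 0.
have DD y z : regular 'X_k y -> regular 'X_k z ->
    vanishing f d 'X_k 0 (D 'X_k (y + z) - (D 'X_k y + D 'X_k z)).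
  by move=> hy hz; rewrite (vector_fieldD vDk) // subrr.
have DM y z : regular 'X_k y -> regular 'X_k z ->
    vanishing f d 'X_k 0 (D 'X_k (y * z) - (y * D 'X_k z + z * D 'X_k y)).
  by move=> hy hz; rewrite (vector_fieldM vDk) // subrr.
have DC (b : C) : vanishing f d 'X_k 0 (D 'X_k (ofpoly b%:MP)).
  by rewrite (vector_fieldC bX vDk).
have hu : twist 'X_k (- d%:Z) ((x k)^-1 ^+ d) by rewrite -mulrN1; exact: twistXn.
have hX' : twist 'X_k 1 ((x k)^-1)^-1 by rewrite invrK; exact: twist_var.
have loc := local_form d0 hf bX bX (fun _ _ => id) (invr_neq0 X0) hX hX' DD DM DC (im _ hu).
have E : der (fun j => ((x k)^-1)^-1 * D 'X_k ((x k)^-1 * x j)) F =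
    ofpoly (\sum_(j < n) a j * f^`M(j)) + (c * ofpoly (d%:R)%:MP) * F.
  rewrite jacobian_sum /der.
  transitivity (\sum_(j < n) (ofpoly (a j) * fpartial j F + c * (x j * fpartial j F))).
    apply: eq_bigr => j _; rewrite invrK [_^-1 * x j]mulrC.
    by rewrite -[x k * _]/(lift_coef D k j) aE; ring.
  rewrite big_split; congr (_ + _); rewrite -mulr_sumr -mulrA; congr (_ * _).
  transitivity (ofpoly (\sum_(j < n) 'X_j * f^`M(j))).
    by rewrite rmorph_sum; apply: eq_bigr => j _; rewrite fpartial_poly rmorphM.
  by rewrite (euler hf) -mul_mpolyC rmorphM.
have /vanishing_normal[y hy yE] : vanishing f d 'X_k d
    (ofpoly (\sum_(j < n) a j * f^`M(j) - g)).
  have -> : ofpoly (\sum_(j < n) a j * f^`M(j) - g) =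
     (der (fun j => ((x k)^-1)^-1 * D 'X_k ((x k)^-1 * x j)) F - ofpoly g) -
     (c * ofpoly (d%:R)%:MP) * F.
    by rewrite E rmorphB; ring.
  apply: vanishingB => //; apply: vanishing_mul0.
  rewrite -[0]addr0; apply: twistM => //; exact: twistC.
by exists y.
Qed.

(** The quotient y of the lemma above does not depend on the open set, so that
    it is a constant. Hence g is in J(f) + (f), and f is in J(f) by Euler's
    identity. *)
Lemma image_form_jacobian g i0 i1 i2 : i0 != i1 -> i2 != i0 -> i2 != i1 ->
  (0 < d)%N -> image_H0_T f d (form g) -> jacobian_ideal f g.
Proof.
move=> i01 i20 i21 d0 [hs [D gD imD]].
have bX k := @basic_openX C n k.
have [a [ha aE]] := global_vector_field_linear i01 i20 i21 gD.
have [c hc cE] := aE i0 (introT orP (or_introl (eqxx _))).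
have [c' hc' cE'] := aE i1 (introT orP (or_intror (eqxx _))).
have [y hy yE] := image_form_at d0 gD (imD _ (bX i0)) hc cE.
have [z hz zE] := image_form_at d0 gD (imD _ (bX i1)) hc' cE'.
(* The two quotients are equal in the function field, since f is not 0. *)
have yz : y = z by apply: (mulIf (ofpoly_neq0 f0)); rewrite -yE -zE.
rewrite -yz in hz; have [q _ qE] := global_section (l := 0) i01 hy hz.
have {}yE : \sum_(j < n) a j * f^`M(j) - g = q * f.
  by apply: ofpoly_inj; rewrite yE qE rmorphM.
have [J0 Jlin] := jacobian_idealP f.
have -> : g = - q * f + \sum_(j < n) a j * f^`M(j).
  by rewrite mulNr -yE opprB subrK.
apply: Jlin; first exact: (mem_jacobian_deg char0 hf).
by exists a.
Qed.

Lemma normal_section_diff s h h' : normal_section f d s -> basic_open h ->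
  basic_open h' -> exists2 w, twist (h * h') 0 w & s h' - s h = w * F.
Proof.
move=> hs bh bh'; apply/vanishing_normal.
have bhh := basic_openM bh bh'.
have H : vanishing f d (h * h') d (s (h * h') - s h').
  by rewrite mulrC; exact: normal_section_restr.
have := vanishingB bhh (normal_section_restr hs bh bh') H.
by congr vanishing; ring.
Qed.

(** The obstruction to lift a section of O_X(d) to a form is in H^1(P^r, O),
    as the kernel of O(d) -> O_X(d) is f O. *)
Lemma normal_section_polynomial s i0 i1 i2 : i0 != i1 -> i2 != i0 -> i2 != i1 ->
  normal_section f d s ->
  exists2 g, g \is d.-homog & zero_section f d (s - form g).
Proof.
move=> i01 i20 i21 hs; have cancelF := mulIf (ofpoly_neq0 f0).
have bX k := @basic_openX C n k.
have [u1 hu1 E1] := normal_section_diff hs (bX i0) (bX i1).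
have [u2 hu2 E2] := normal_section_diff hs (bX i0) (bX i2).
have [u3 hu3 E3] := normal_section_diff hs (bX i1) (bX i2).
have u12 : u1 - u2 = - u3.
  apply: cancelF; rewrite mulrBl mulNr -E1 -E2 -E3; ring.
have [v [hv hv1]] : exists v, twist 'X_i0 0 v /\ twist 'X_i1 0 (u1 + v).
  apply: (cech_H1 i01 i20 i21 hu1 hu2); rewrite u12.
  by apply: twistN => //; exact: basic_openM.
have tF h w : basic_open h -> twist h 0 w -> twist h d (w * F).
  move=> bh hw; rewrite -[d%:Z]add0r; apply: (twistM bh hw).
  exact/twist_poly/zhomog_dhomog.
have [hsT _] := hs.
have xE : s 'X_i0 - v * F = s 'X_i1 - (u1 + v) * F.
  by rewrite mulrDl -E1; ring.
have [g hg gE] : exists2 g : P, g \is d.-homog & s 'X_i0 - v * F = ofpoly g.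
  apply: (global_section i01); last rewrite xE.
    exact: (twistB (bX i0) (hsT _ (bX i0)) (tF _ _ (bX i0) hv)).
  exact: (twistB (bX i1) (hsT _ (bX i1)) (tF _ _ (bX i1) hv1)).
exists g => // h bh.
have [w0 hw0 W0] := normal_section_diff hs (bX i0) bh.
have [w1 hw1 W1] := normal_section_diff hs (bX i1) bh.
have S0 : s h - ofpoly g = (w0 + v) * F by rewrite -gE mulrDl -W0; ring.
have S1 : s h - ofpoly g = (w1 + (u1 + v)) * F by rewrite -gE xE [RHS]mulrDl -W1; ring.
have same : w0 + v = w1 + (u1 + v) by apply: cancelF; rewrite -S0 -S1.
have [h0 [e e0 hh]] := bh.
apply/vanishing_normal; exists (w0 + v); last exact: S0.
apply: (twist_cap h0 hh _ i01); first by rewrite e0.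
- rewrite mulrC; apply: (twistD (basic_openM (bX i0) bh) hw0).
  exact: (twist_restr (bX i0) bh hv).
- rewrite same mulrC; apply: (twistD (basic_openM (bX i1) bh) hw1).
  exact: (twist_restr (bX i1) bh hv1).
Qed.

(** Membership in the ideal generated by J(f) in the localization P[1/h]. *)
Definition jacobian_loc h (y : K) : Prop :=
  exists N q, jacobian_ideal f q /\ ofpoly h ^+ N * y = ofpoly q.

Lemma jacobian_locD h y z : jacobian_loc h y -> jacobian_loc h z ->
  jacobian_loc h (y + z).
Proof.
have [J0 Jlin] := jacobian_idealP f.
move=> [N [q [Jq qE]]] [M [r [Jr rE]]]; exists (N + M)%N, (h ^+ M * q + (h ^+ N * r + 0)).
split; first by apply: (Jlin) => //; exact: Jlin.
by rewrite addr0 rmorphD !rmorphM !rmorphXn /= -qE -rE exprD; ring.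
Qed.

Lemma jacobian_loc0 h : jacobian_loc h 0.
Proof.
by exists 0%N, 0; split; [case: (jacobian_idealP f) | rewrite mulr0 rmorph0].
Qed.

Lemma jacobian_loc_twist h k y q : basic_open h -> twist h k y ->
  jacobian_ideal f q -> jacobian_loc h (y * ofpoly q).
Proof.
move=> bh hy Jq; have [J0 Jlin] := jacobian_idealP f.
have [e [e0 hh h0 den _]] := basic_open_den bh.
have [N /(_ _ (leqnn _))[p _ ->]] := den _ _ hy.
exists N, (p * q + 0); split; first exact: Jlin.
have H0 := expf_neq0 N (ofpoly_neq0 h0).
by rewrite addr0 rmorphM mulrA [_ * (_ / _)]mulrC (divfK H0).
Qed.

(** Otherwise the ideal I of the a with a X_i^M g in J(f) for some M contains
    no power of X_i, and lies in a homogeneous prime p without X_i. This is a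
    point of X, as f is in J(f). Near it g is a combination of the derivatives
    of f, whose denominators give an element of I outside p. *)
Lemma H0_N'_saturated s g i : g \is d.-homog -> (0 < d)%N -> H0_N' f d s ->
  zero_section f d (s - form g) ->
  exists M, jacobian_ideal f ('X_i ^+ M * g).
Proof.
move=> hg d0 /(H0_N'_derivation hf f0)[hs loc] sg0.
have [J0 Jlin] := jacobian_idealP f.
have Jmul b c : jacobian_ideal f b -> jacobian_ideal f (c * b).
  by move=> Jb; rewrite -[_ * b]addr0; exact: Jlin.
pose I a := exists M, jacobian_ideal f (a * ('X_i ^+ M * g)).
apply: contrapT => no.
have IX k : ~ I ('X_i ^+ k).
  by move=> [M JM]; apply: no; exists (k + M)%N; rewrite exprD -mulrA.
have idI : ideal_pred I.
  split=> [|a b c [M Ja] [N Jb]]; first by exists 0%N; rewrite mul0r.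
  exists (M + N)%N; rewrite exprD.
  have -> : (c * a + b) * ('X_i ^+ M * 'X_i ^+ N * g) =
    (c * 'X_i ^+ N) * (a * ('X_i ^+ M * g)) + 'X_i ^+ M * (b * ('X_i ^+ N * g)) by ring.
  by apply: (Jlin) => //; exact: Jmul.
have homI a k : I a -> I (pihomog mdeg k a).
  move=> [M Ja]; exists M; have := jacobian_pihomog hf (M + d + k) Ja.
  rewrite mulrC pihomogM; first by rewrite mulrC.
  by apply: dhomogM => //; exact: dhomogXn.
have [p [pp Ip pX]] := homogeneous_prime_avoiding idI homI IX.
have pf : p f.
  apply: Ip; exists 0%N; rewrite mulrC; apply: Jmul.
  exact: (mem_jacobian_deg char0 hf).
have [h [a [bh ph ha hE]]] := loc p pp pf.
have /vanishing_normal[y hy yE] := vanishingD bh hE (sg0 h bh).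
have gE : ofpoly g = \sum_(j < n) a j * ofpoly f^`M(j) + (- y) * F.
  have -> : (\sum_(j < n) a j * ofpoly f^`M(j) : K) = der a F by rewrite der_poly.
  rewrite mulNr -yE -[(s - form g) h]/(s h - ofpoly g).
  by rewrite addrA subrK opprB addrC subrK.
have [N [q [Jq qE]]] : jacobian_loc h (ofpoly g).
  rewrite gE; apply: jacobian_locD.
    elim/big_ind: _ => [||j _]; [exact: jacobian_loc0 | exact: jacobian_locD |].
    apply: (jacobian_loc_twist bh (ha j)); exists (fun l => (l == j)%:R).
    rewrite (bigD1 j) //= eqxx mul1r big1 ?addr0 // => l lj.
    by rewrite (negPf lj) mul0r.
  apply: (jacobian_loc_twist bh (twistN bh hy)); exact: (mem_jacobian_deg char0 hf).
have phN : p (h ^+ N).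
  apply: Ip; exists 0%N; rewrite mul1r.
  by have -> : h ^+ N * g = q by apply: ofpoly_inj; rewrite rmorphM rmorphXn.
have [_ [p1 pprime] _ _] := pp.
elim: N phN {qE} => [|N IH]; first by rewrite expr0 => /p1.
by rewrite exprS => /pprime[].
Qed.

Theorem jacobian_cohomology_iso i0 i1 i2 : i0 != i1 -> i2 != i0 -> i2 != i1 ->
  induces_iso (Jsat_deg f d) (J_deg f d) (H0_N' f d) (image_H0_T f d)
    (@form_section C n).
Proof.
move=> i01 i20 i21; have n0 : (0 < n)%N := leq_ltn_trans (leq0n i0) (ltn_ord i0).
split.
- split; [exact: Jsat_deg_subspace | exact: J_deg_subspace | exact: J_deg_sub].
- split; [exact: H0_N'_subspace | exact: image_H0_T_subspace | exact: image_H0_T_sub].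
- split; [exact: form_section_linear | exact: Jsat_deg_H0_N' | exact: J_deg_image].
- move=> g hg im; case: (posnP d) => [d0|d0].
    by rewrite (Jsat_deg_degree0 d0 n0 hg); case: (J_deg_subspace f d).
  by case: (hg) => hgd _; split=> //; exact: (image_form_jacobian i01 i20 i21).
- move=> s hs; case: (posnP d) => [d0|d0].
    exists 0; first by case: (Jsat_deg_subspace f d).
    have -> : s - form 0 = s.
      by apply/funext => h; rewrite -[LHS]/(s h - ofpoly 0) rmorph0 subr0.
    have [hns _] := hs.
    by apply: zero_section_image => //; exact: normal_section_degree0.
  have [hns _] := hs.
  have [g hg sg0] := normal_section_polynomial i01 i20 i21 hns.
  exists g.
    by split=> //; apply/jacobian_sat_variables => i; exact: (H0_N'_saturated _ hg d0 hs).
  apply: zero_section_image => //.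
  have -> : s - form g = (-1) *: form g + s by rewrite scaleN1r addrC.
  apply: normal_sectionP => //; exact: normal_section_form.
Qed.

End JacobianCohomology.

Unset Implicit Arguments.

(* The first three clauses identify H^0(X, N'_X) with the set of first order  *)
(* locally trivial deformations of X, by s |-> (f + eps s = 0); the last one  *)
(* is the isomorphism of vector spaces g |-> (f + eps g = 0) from             *)
(* H^0_m(R(f))_d to H^0(X, N'_X) modulo the image of H^0(P^r, T_(P^r)).       *)
Theorem corollary2p2 (R : realType) (r d : nat) (f : {mpoly R[i][r.+1]})
    (hr : (2 <= r)%N) (hred : reduced_poly f) (hf : f \is d.-homog) :
  [/\ forall s, H0_N' f d s ->
        locally_trivial_deformation f d (deformation_of f d s),
      forall I, locally_trivial_deformation f d I ->
        exists2 s, H0_N' f d s & same_subscheme I (deformation_of f d s),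
      forall s t, H0_N' f d s -> H0_N' f d t ->
        same_subscheme (deformation_of f d s) (deformation_of f d t) <->
        zero_section f d (s - t)
    & induces_iso (Jsat_deg f d) (J_deg f d) (H0_N' f d) (image_H0_T f d)
        (@form_section R[i] r.+1)].
Proof.
have char0 : [pchar R[i]] =i pred0 := Num.Theory.pchar_num _.
have f0 : f != 0.
  apply/eqP => f0; have := hred 0 0; rewrite f0 mulr0 => /(_ erefl).
  by rewrite unitr0.
pose i0 : 'I_r.+1 := inord 0; pose i1 : 'I_r.+1 := inord 1.
pose i2 : 'I_r.+1 := inord 2.
have neq (a b : nat) : (a <= r)%N -> (b <= r)%N -> a != b ->
    inord a != inord b :> 'I_r.+1.
  by move=> ar br; rewrite -val_eqE /= !inordK.
split.
- by move=> s; exact: deformation_of_locally_trivial.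
- by move=> I; exact: locally_trivial_has_section.
- by move=> s t [hs _] [ht _]; exact: same_deformation.
- apply: (@jacobian_cohomology_iso _ _ _ _ char0 hf f0 i0 i1 i2); apply: neq => //.
  + exact: ltnW.
  + exact: ltnW.
Qed.
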